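(* Let $R$ be a commutative ring. For every Freudenthal $R$-algebra $J$ with norm $N_J$, $$\{\alpha\in R^\times\mid\alpha N_J\cong N_J\}=\{N_J(x)\in R^\times\mid x\text{ invertible in }J\},$$ where $\alpha N_J\cong N_J$ means that there is $\phi\in\mathrm{GL}(J)$ such that $\alpha N_J=N_J\circ\phi$ as polynomial laws.
   Context: Polynomial laws. A polynomial law $f:M\to N$ between $R$-modules is a family of maps $f_S:M\otimes S\to N\otimes S$, functorial in the commutative $R$-algebra $S$; it is homogeneous of degree $d$ if $f_S(sx)=s^df_S(x)$. Quadratic maps (resp. cubic forms) are laws homogeneous of degree 2 (resp. of degree 3 with values in $R$). Para-quadratic algebras. A para-quadratic $R$-algebra is an $R$-module $J$ with a quadratic map $U:J\to\mathrm{End}_R(J)$, $x\mapsto U_x$, and $1_J\in J$ with $U_{1_J}=\mathrm{Id}_J$; homomorphisms are $R$-linear maps preserving $1$ and satisfying $\phi(U_xy)=U_{\phi(x)}\phi(y)$. An element $x$ is invertible if $U_x$ is bijective. Composition algebras. A composition $R$-algebra is a unital, not necessarily associative $R$-algebra $C$, finitely generated projective as an $R$-module, with a quadratic form $n_C$ such that $n_C(xy)=n_C(x)n_C(y)$, $n_C(1_C)=1$, and $n_C(x,y):=n_C(x+y)-n_C(x)-n_C(y)$ induces an isomorphism $C\to C^*$. Put $\mathrm{Tr}_C(x)=n_C(x,1_C)$, $\bar x=\mathrm{Tr}_C(x)1_C-x$. One can write $R=\prod_{e=0}^3R_e$, $C=\prod_{e=0}^3 C_e$ with $C_e$ a composition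 $R_e$-algebra of constant rank $2^e$ (in rank 1, $C_0=R_0$ with norm $\alpha^2$, and 2 is invertible in $R_0$). $C$ is split if $C_1\cong R_1\times R_1$, $C_2\cong\mathrm{Mat}_2(R_2)$, and $C_3\cong\mathrm{Zor}(R_3)$. Here $\mathrm{Zor}(R)$ is the module of matrices $\begin{pmatrix}\alpha_1&u\\ x&\alpha_2\end{pmatrix}$, $\alpha_i\in R$, $u,x\in R^3$, with product $$\begin{pmatrix}\alpha_1&u\\ x&\alpha_2\end{pmatrix}\begin{pmatrix}\beta_1&v\\ y&\beta_2\end{pmatrix}=\begin{pmatrix}\alpha_1\beta_1-u^{\top}y&\alpha_1v+\beta_2u+x\times y\\ \beta_1x+\alpha_2y+u\times v&-x^{\top}v+\alpha_2\beta_2\end{pmatrix}$$ and norm $\alpha_1\alpha_2+u^\top x$. Freudenthal algebras. $\mathrm{Her}_3(C)$ is the $R$-module of matrices $$x=\begin{pmatrix}\alpha_1&c_3&\bar c_2\\ \bar c_3&\alpha_2&c_1\\ c_2&\bar c_1&\alpha_3\end{pmatrix},\quad\alpha_i\in R,\ c_i\in C.$$ With $x$ having coordinates $(\alpha_i,c_i)$ and $y$ coordinates $(\beta_i,d_i)$, indices mod 3, put $T(x,y)=\sum_i(\alpha_i\beta_i+n_C(c_i,d_i))$; let $x^\sharp$ have coordinates $(\alpha_{i+1}\alpha_{i+2}-n_C(c_i),\,-\alpha_ic_i+\overline{c_{i+1}c_{i+2}})$; $x\times y=(x+y)^\sharp-x^\sharp-y^\sharp$. The identity matrix and $U_xy=T(x,y)x-x^\sharp\times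 y$ make $\mathrm{Her}_3(C)$ a para-quadratic (indeed Jordan) algebra. Its norm is the cubic form $$N(x)=\alpha_1\alpha_2\alpha_3-\sum_{i}\alpha_in_C(c_i)+\mathrm{Tr}_C(c_1c_2c_3)$$ (unambiguous, as $\mathrm{Tr}_C((ab)c)=\mathrm{Tr}_C(a(bc))$). A split Freudenthal $R$-algebra is $\mathrm{Her}_3(C)$ with $C$ a split composition $R$-algebra. A Freudenthal $R$-algebra is a para-quadratic $R$-algebra $J$ such that $J\otimes S$ is isomorphic to a split Freudenthal $S$-algebra for some faithfully flat commutative $R$-algebra $S$. Its norm $N_J:J\to R$ is the unique cubic form that over such an $S$ corresponds to the norm $N$ just defined; $N_J$ depends only on the para-quadratic algebra $J$. *)

(* Defs.v *)
From HB Require Import structures.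
From mathcomp Require Import all_boot all_order all_algebra.
From mathcomp Require Import generic_quotient boolp classical_sets.
Set Implicit Arguments. Unset Strict Implicit. Unset Printing Implicit Defensive.
Import GRing.Theory.
Local Open Scope ring_scope.
Local Open Scope quotient_scope.

(* Rings are [comPzRingType], so that the zero ring is allowed: it occurs among
   the factors R_e of a decomposition of R.  A commutative R-algebra is a
   commutative ring S with a ring morphism phi : R -> S. *)

Section Hom.
Variables (R : comPzRingType) (M N : lmodType R).

Record hom := Hom { hom_fun :> M -> N; hom_linear : linear hom_fun }.

HB.instance Definition _ (h : hom) :=
  GRing.isLinear.Build R M N *:%R (hom_fun h) (@hom_linear h).

HB.instance Definition _ := gen_eqMixin hom.
HB.instance Definition _ := gen_choiceMixin hom.

Lemma homP (f g : hom) : (forall x, f x = g x) -> f = g.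
Proof.
case: f g => [f lf] [g lg] /= e.
have efg : f = g by apply: funext.
by case: _ / efg lg => lg; congr Hom; apply: Prop_irrelevance.
Qed.

Lemma hom0_subproof : linear (fun _ : M => 0 : N).
Proof. by move=> a u v; rewrite scaler0 addr0. Qed.
Definition hom0 := Hom hom0_subproof.

Lemma homD_subproof (f g : hom) : linear (fun x => f x + g x).
Proof. by move=> a u v; rewrite !linearP scalerDr addrACA. Qed.
Definition homD f g := Hom (homD_subproof f g).

Lemma homN_subproof (f : hom) : linear (fun x => - f x).
Proof. by move=> a u v; rewrite linearP opprD scalerN. Qed.
Definition homN f := Hom (homN_subproof f).

Lemma homZ_subproof (r : R) (f : hom) : linear (fun x => r *: f x).
Proof. by move=> a u v; rewrite linearP scalerDr !scalerA mulrC. Qed.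
Definition homZ r f := Hom (homZ_subproof r f).

Fact homDA : associative homD.
Proof. by move=> f g h; apply: homP => x /=; rewrite addrA. Qed.
Fact homDC : commutative homD.
Proof. by move=> f g; apply: homP => x /=; rewrite addrC. Qed.
Fact hom0D : left_id hom0 homD.
Proof. by move=> f; apply: homP => x /=; rewrite add0r. Qed.
Fact homND : left_inverse hom0 homN homD.
Proof. by move=> f; apply: homP => x /=; rewrite addNr. Qed.
HB.instance Definition _ := GRing.isZmodule.Build hom homDA homDC hom0D homND.

Fact homZA a b (f : hom) : homZ a (homZ b f) = homZ (a * b) f.
Proof. by apply: homP => x /=; rewrite scalerA. Qed.
Fact hom1Z : left_id 1 homZ.
Proof. by move=> f; apply: homP => x /=; rewrite scale1r. Qed.
Fact homZDr : right_distributive homZ +%R.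
Proof. by move=> a f g; apply: homP => x /=; rewrite scalerDr. Qed.
Fact homZDl (f : hom) : {morph homZ^~ f : a b / a + b}.
Proof. by move=> a b; apply: homP => x /=; rewrite scalerDl. Qed.
HB.instance Definition _ :=
  GRing.Zmodule_isLmodule.Build R hom homZA hom1Z homZDr homZDl.

Lemma homDE (f g : hom) x : (f + g) x = f x + g x. Proof. by []. Qed.
Lemma homZE a (f : hom) x : (a *: f) x = a *: f x. Proof. by []. Qed.
Lemma homNE (f : hom) x : (- f) x = - f x. Proof. by []. Qed.
End Hom.
Arguments Hom {R M N}.

Lemma homid_subproof (R : comPzRingType) (M : lmodType R) :
  linear (fun x : M => x).
Proof. by []. Qed.
Definition homid (R : comPzRingType) (M : lmodType R) : hom M M :=
  Hom _ (@homid_subproof R M).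

Section Bil.
Variables (R : comPzRingType) (M N P : lmodType R).
Record bil := Bil {
  bil_fun :> M -> N -> P;
  bil_linl : forall y, linear (bil_fun^~ y);
  bil_linr : forall x, linear (bil_fun x) }.
Variable b : bil.
Lemma bilDl y : {morph b^~ y : x x' / x + x'}.
Proof. by move=> x x'; have := bil_linl b y 1 x x'; rewrite !scale1r. Qed.
Lemma bilDr x : {morph b x : y y' / y + y'}.
Proof. by move=> y y'; have := bil_linr b x 1 y y'; rewrite !scale1r. Qed.
Lemma bil0l y : b 0 y = 0.
Proof. by apply: (addrI (b 0 y)); rewrite -bilDl !addr0. Qed.
Lemma bil0r x : b x 0 = 0.
Proof. by apply: (addrI (b x 0)); rewrite -bilDr !addr0. Qed.
Lemma bilZl a x y : b (a *: x) y = a *: b x y.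
Proof. by have := bil_linl b y a x 0; rewrite /= !addr0 bil0l addr0. Qed.
Lemma bilZr a x y : b x (a *: y) = a *: b x y.
Proof. by have := bil_linr b x a y 0; rewrite !addr0 bil0r addr0. Qed.
Lemma bilNl x y : b (- x) y = - b x y.
Proof. by rewrite -scaleN1r bilZl scaleN1r. Qed.
Lemma bilNr x y : b x (- y) = - b x y.
Proof. by rewrite -scaleN1r bilZr scaleN1r. Qed.
End Bil.
Arguments Bil {R M N P}.

Lemma mul_bil_subproof (R : comPzRingType) (y : R^o) :
  linear ((fun x y : R^o => x * y : R^o)^~ y).
Proof. by move=> a u v; rewrite mulrDl [in LHS]/GRing.scale /= -mulrA. Qed.
Lemma mul_bil_subproof2 (R : comPzRingType) (x : R^o) :
  linear ((fun x y : R^o => x * y : R^o) x).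
Proof. by move=> a u v; rewrite mulrDr [in LHS]/GRing.scale /= mulrCA. Qed.
Definition mul_bil (R : comPzRingType) : bil R^o R^o R^o :=
  Bil _ (@mul_bil_subproof R) (@mul_bil_subproof2 R).

Lemma scale_bil_subproof (R : comPzRingType) (M : lmodType R) (y : M) :
  linear ((fun (a : R^o) (x : M) => (a : R) *: x)^~ y).
Proof. by move=> a u v; rewrite scalerDl scalerA. Qed.
Lemma scale_bil_subproof2 (R : comPzRingType) (M : lmodType R) (a : R^o) :
  linear ((fun (a : R^o) (x : M) => (a : R) *: x) a).
Proof. by move=> b u v; rewrite scalerDr !scalerA mulrC. Qed.
Definition scale_bil (R : comPzRingType) (M : lmodType R) : bil R^o M M :=
  Bil _ (@scale_bil_subproof R M) (@scale_bil_subproof2 R M).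

(* [tens phi M] is M (x)_R S, built as the quotient of the free commutative
   monoid on M * S (lists up to permutation) by the bilinearity and balancing
   relations; these make every class invertible. *)

Section Tens.
Variables (R S : comPzRingType) (phi : {rmorphism R -> S}) (M : lmodType R).
Implicit Types (a b c : seq (M * S)).

Inductive tens_rel : seq (M * S) -> seq (M * S) -> Prop :=
| tens_refl a : tens_rel a a
| tens_sym a b : tens_rel a b -> tens_rel b a
| tens_trans a b c : tens_rel a b -> tens_rel b c -> tens_rel a c
| tens_cat a a' b b' :
    tens_rel a a' -> tens_rel b b' -> tens_rel (a ++ b) (a' ++ b')
| tens_catC a b : tens_rel (a ++ b) (b ++ a)
| tens_zero s : tens_rel [:: (0, s)] [::]
| tens_addl m m' s : tens_rel [:: (m + m', s)] [:: (m, s); (m', s)]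
| tens_addr m s s' : tens_rel [:: (m, s + s')] [:: (m, s); (m, s')]
| tens_bal r m s : tens_rel [:: (r *: m, s)] [:: (m, phi r * s)].

Lemma tens_catCA a b c : tens_rel (a ++ b ++ c) (b ++ a ++ c).
Proof.
by rewrite !catA; apply: tens_cat; [exact: tens_catC|exact: tens_refl].
Qed.

Definition tens_relb a b := `[< tens_rel a b >].
Lemma tens_relb_refl : reflexive tens_relb.
Proof. by move=> a; apply/asboolP; apply: tens_refl. Qed.
Lemma tens_relb_sym : symmetric tens_relb.
Proof. by move=> a b; apply/asboolP/asboolP => h; apply: tens_sym. Qed.
Lemma tens_relb_trans : transitive tens_relb.
Proof.
by move=> b a c /asboolP h /asboolP h'; apply/asboolP; apply: tens_trans h h'.
Qed.
Canonical tens_equiv :=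
  EquivRel tens_relb tens_relb_refl tens_relb_sym tens_relb_trans.

Definition tens := {eq_quot tens_equiv}.
HB.instance Definition _ := Choice.on tens.

Let cls (a : seq (M * S)) : tens := \pi_({eq_quot tens_equiv}) a.
Let lst (x : tens) : seq (M * S) := repr (x : {eq_quot tens_equiv}).

Lemma tens_clsP a b : (cls a = cls b) <-> tens_rel a b.
Proof.
split=> [/eqmodP/asboolP //|h]; apply/eqmodP; exact/asboolP.
Qed.
Lemma tens_lstK x : cls (lst x) = x. Proof. exact: reprK. Qed.
Lemma tens_lst_cls a : tens_rel (lst (cls a)) a.
Proof. by apply/tens_clsP; rewrite tens_lstK. Qed.

Definition tens0 : tens := cls [::].
Definition tensD (x y : tens) : tens := cls (lst x ++ lst y).
Definition tensN (x : tens) : tens := cls [seq (- p.1, p.2) | p <- lst x].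
Definition tensZ (t : S) (x : tens) : tens :=
  cls [seq (p.1, t * p.2) | p <- lst x].
Definition tpure (m : M) (s : S) : tens := cls [:: (m, s)].

Lemma tensD_cls a b : tensD (cls a) (cls b) = cls (a ++ b).
Proof. by apply/tens_clsP; apply: tens_cat; apply: tens_lst_cls. Qed.

Lemma tens_rel_map (f : M * S -> M * S) :
  (forall s, tens_rel [:: f (0, s)] [::]) ->
  (forall m m' s, tens_rel [:: f (m + m', s)] [:: f (m, s); f (m', s)]) ->
  (forall m s s', tens_rel [:: f (m, s + s')] [:: f (m, s); f (m, s')]) ->
  (forall r m s, tens_rel [:: f (r *: m, s)] [:: f (m, phi r * s)]) ->
  forall a b, tens_rel a b -> tens_rel (map f a) (map f b).
Proof.
move=> f0 fl fr fb a b; elim=> /= {a b}; do ?by [].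
- by move=> a; apply: tens_refl.
- by move=> a b _ h; apply: tens_sym.
- by move=> a b c _ h _ h'; apply: tens_trans h h'.
- by move=> a a' b b' _ h _ h'; rewrite !map_cat; apply: tens_cat.
- by move=> a b; rewrite !map_cat; apply: tens_catC.
Qed.

Lemma tens_zeror m : tens_rel [:: (m, 0)] [::].
Proof.
apply: (tens_trans (b := [:: (0 *: m, 0)])).
  by apply: tens_sym; have := tens_bal 0 m 0; rewrite mulr0.
by rewrite scale0r; apply: tens_zero.
Qed.

Lemma tensN_cls a : tensN (cls a) = cls [seq (- p.1, p.2) | p <- a].
Proof.
apply/tens_clsP/tens_rel_map/tens_lst_cls => /=.
- by move=> s; rewrite oppr0; apply: tens_zero.
- by move=> m m' s; rewrite opprD; apply: tens_addl.
- by move=> m s s'; apply: tens_addr.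
- by move=> r m s; rewrite -scalerN; apply: tens_bal.
Qed.

Lemma tensZ_cls t a : tensZ t (cls a) = cls [seq (p.1, t * p.2) | p <- a].
Proof.
apply/tens_clsP/tens_rel_map/tens_lst_cls => /=.
- by move=> s; apply: tens_zero.
- by move=> m m' s; apply: tens_addl.
- by move=> m s s'; rewrite mulrDr; apply: tens_addr.
- by move=> r m s; rewrite mulrCA; apply: tens_bal.
Qed.

Lemma tens_clsW (P : tens -> Prop) : (forall a, P (cls a)) -> forall x, P x.
Proof. by move=> h x; rewrite -(tens_lstK x). Qed.

Fact tensDA : associative tensD.
Proof.
elim/tens_clsW=> a; elim/tens_clsW=> b; elim/tens_clsW=> c.
by rewrite !tensD_cls catA.
Qed.
Fact tensDC : commutative tensD.
Proof.
elim/tens_clsW=> a; elim/tens_clsW=> b; rewrite !tensD_cls.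
by apply/tens_clsP; apply: tens_catC.
Qed.
Fact tens0D : left_id tens0 tensD.
Proof. by elim/tens_clsW=> a; rewrite tensD_cls. Qed.
Fact tensND : left_inverse tens0 tensN tensD.
Proof.
elim/tens_clsW=> a; rewrite tensN_cls tensD_cls; apply/tens_clsP.
elim: a => [|[m s] a IH] /=; first exact: tens_refl.
apply: (tens_trans (b := [:: (- m, s); (m, s)] ++
                         ([seq (- p.1, p.2) | p <- a] ++ a))).
  exact: (tens_cat (tens_refl [:: (- m, s)]) (tens_catCA _ [:: (m, s)] _)).
rewrite -[[::]]/([::] ++ [::]); apply: tens_cat => //.
apply: tens_trans (tens_zero s); rewrite -(addNr m).
by apply: tens_sym; apply: tens_addl.
Qed.
HB.instance Definition _ := GRing.isZmodule.Build tens tensDA tensDC tens0D tensND.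

Fact tensZA (u t : S) (x : tens) : tensZ u (tensZ t x) = tensZ (u * t) x.
Proof.
elim/tens_clsW: x => a; rewrite !tensZ_cls -map_comp; congr cls.
by apply: eq_map => p /=; rewrite mulrA.
Qed.
Fact tens1Z : left_id 1 tensZ.
Proof.
elim/tens_clsW=> a; rewrite tensZ_cls -[in RHS](map_id a); congr cls.
by apply: eq_map => -[m s] /=; rewrite mul1r.
Qed.
Fact tensZDr : right_distributive tensZ +%R.
Proof.
move=> t; elim/tens_clsW=> a; elim/tens_clsW=> b.
by rewrite -[RHS]/(tensD _ _) -[_ + _]/(tensD _ _) tensD_cls !tensZ_cls tensD_cls map_cat.
Qed.
Fact tensZDl (x : tens) : {morph tensZ^~ x : t u / t + u}.
Proof.
elim/tens_clsW: x => a t u; rewrite -[RHS]/(tensD _ _) !tensZ_cls tensD_cls.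
apply/tens_clsP; elim: a => [|[m s] a IH] /=; first exact: tens_refl.
set A := map _ a in IH *; set B := map _ a in IH *; set D := map _ a in IH *.
apply: (tens_trans (b := [:: (m, t * s); (m, u * s)] ++ (B ++ D))).
  rewrite -cat1s; apply: tens_cat IH; rewrite mulrDl; exact: tens_addr.
exact: (tens_cat (tens_refl [:: (m, t * s)]) (tens_catCA [:: (m, u * s)] _ _)).
Qed.
HB.instance Definition _ :=
  GRing.Zmodule_isLmodule.Build S tens tensZA tens1Z tensZDr tensZDl.

Lemma tpureDl m m' s : tpure (m + m') s = tpure m s + tpure m' s.
Proof.
rewrite -[RHS]/(tensD _ _) tensD_cls; apply/tens_clsP; exact: tens_addl.
Qed.
Lemma tpureDr m s s' : tpure m (s + s') = tpure m s + tpure m s'.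
Proof.
rewrite -[RHS]/(tensD _ _) tensD_cls; apply/tens_clsP; exact: tens_addr.
Qed.
Lemma tpure_bal r m s : tpure (r *: m) s = tpure m (phi r * s).
Proof. by apply/tens_clsP; exact: tens_bal. Qed.
Lemma tpure0l s : tpure 0 s = 0.
Proof. by apply/tens_clsP; exact: tens_zero. Qed.
Lemma tpureZ t m s : t *: tpure m s = tpure m (t * s).
Proof. by rewrite -[LHS]/(tensZ _ _) tensZ_cls. Qed.

Lemma tens_ind (P : tens -> Prop) :
  (forall m s, P (tpure m s)) -> (forall x y, P x -> P y -> P (x + y)) ->
  forall x, P x.
Proof.
move=> Pp PD; elim/tens_clsW; elim=> [|[m s] a IH].
  by have := Pp 0 0; rewrite tpure0l.
rewrite (_ : cls _ = tpure m s + cls a) ?tensD_cls; first exact: PD.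
by rewrite -[RHS]/(tensD _ _) tensD_cls.
Qed.

(* This is the induced additive map only if h is balanced, see [tliftE]. *)
Definition tlift (A : zmodType) (h : M -> S -> A) (x : tens) : A :=
  \sum_(p <- lst x) h p.1 p.2.

Definition balanced (A : zmodType) (h : M -> S -> A) : Prop :=
  [/\ forall s, {morph h^~ s : m m' / m + m'},
      forall m, {morph h m : s s' / s + s'}
    & forall r m s, h (r *: m) s = h m (phi r * s)].

Section Lift.
Variables (A : zmodType) (h : M -> S -> A) (bal_h : balanced h).

Lemma tlift_cls a : tlift h (cls a) = \sum_(p <- a) h p.1 p.2.
Proof.
case: bal_h => hl hr hb; rewrite /tlift.
have: tens_rel (lst (cls a)) a by apply: tens_lst_cls.
move: (lst _) => c; elim=> {a c} //=.
- by move=> a b c _ -> _ ->.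
- by move=> a a' b b' _ e _ e'; rewrite !big_cat e e'.
- by move=> a b; rewrite !big_cat /= addrC.
- move=> s; rewrite big_seq1 big_nil /=.
  by apply: (addrI (h 0 s)); rewrite -hl !addr0.
- by move=> m m' s; rewrite !big_cons !big_nil /= !addr0 hl.
- by move=> m s s'; rewrite !big_cons !big_nil /= !addr0 hr.
- by move=> r m s; rewrite !big_seq1 /= hb.
Qed.

Lemma tliftD : {morph tlift h : x y / x + y}.
Proof.
elim/tens_clsW=> a; elim/tens_clsW=> b.
by rewrite -[_ + _]/(tensD _ _) tensD_cls !tlift_cls big_cat.
Qed.
Lemma tliftE m s : tlift h (tpure m s) = h m s.
Proof. by rewrite tlift_cls big_seq1. Qed.
Lemma tlift0 : tlift h 0 = 0.
Proof. by apply: (addrI (tlift h 0)); rewrite -tliftD !addr0. Qed.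
End Lift.
End Tens.
Arguments tpure {R S} phi {M} m s.

Section TensOps.
Variables (R S : comPzRingType) (phi : {rmorphism R -> S}).

Lemma tens_ext (M : lmodType R) (A : zmodType) (f g : tens phi M -> A) :
  {morph f : x y / x + y} -> {morph g : x y / x + y} ->
  (forall m s, f (tpure phi m s) = g (tpure phi m s)) -> f =1 g.
Proof.
by move=> fD gD e; elim/tens_ind => [//|x y ex ey]; rewrite fD gD ex ey.
Qed.

Lemma tens_linear (M : lmodType R) (A : lmodType S) (f : tens phi M -> A) :
  {morph f : x y / x + y} ->
  (forall t m s, f (tpure phi m (t * s)) = t *: f (tpure phi m s)) -> linear f.
Proof.
move=> fD fZ a u v; rewrite fD; congr (_ + _).
apply: (@tens_ext _ _ (fun x => f (a *: x)) (fun x => a *: f x)) => [x y|x y|m s].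
- by rewrite scalerDr fD.
- by rewrite fD scalerDr.
- by rewrite tpureZ fZ.
Qed.

Section Tmap.
Variables (M N : lmodType R) (f : {linear M -> N}).
Definition tmap : tens phi M -> tens phi N :=
  tlift (fun m s => tpure phi (f m) s).
Lemma tmap_bal : balanced phi (fun m s => tpure phi (f m) s).
Proof.
split=> [s m m'|m s s'|r m s]; rewrite ?linearD ?tpureDl ?tpureDr //.
by rewrite linearZ /= tpure_bal.
Qed.
Lemma tmapE m s : tmap (tpure phi m s) = tpure phi (f m) s.
Proof. exact: tliftE tmap_bal _ _. Qed.
Lemma tmapD : {morph tmap : x y / x + y}. Proof. exact: tliftD tmap_bal. Qed.
Lemma tmap_linear : linear tmap.
Proof.
by apply: tens_linear tmapD _ => t m s; rewrite !tmapE tpureZ.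
Qed.
HB.instance Definition _ := GRing.isLinear.Build S _ _ *:%R tmap tmap_linear.
End Tmap.

Definition tring : tens phi R^o -> S^o := tlift (fun (r : R^o) s => phi r * s : S^o).
Lemma tring_bal : balanced phi (fun (r : R^o) s => phi r * s : S^o).
Proof.
split=> [s m m'|m s s'|r m s] /=; rewrite ?rmorphD ?mulrDl ?mulrDr //.
by rewrite [r *: m]/(r * m) rmorphM mulrCA mulrA.
Qed.
Lemma tringE r s : tring (tpure phi (r : R^o) s) = phi r * s.
Proof. exact: tliftE tring_bal _ _. Qed.
Lemma tringD : {morph tring : x y / x + y}. Proof. exact: tliftD tring_bal. Qed.
Lemma tring_linear : linear tring.
Proof.
apply: tens_linear tringD _ => t m s; rewrite !tringE mulrCA.
by [].
Qed.
HB.instance Definition _ := GRing.isLinear.Build S _ _ *:%R tring tring_linear.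

Section Tbil.
Variables (M N P : lmodType R) (b : bil M N P).
Let inner m s (y : tens phi N) : tens phi P :=
  tlift (fun n t => tpure phi (b m n) (s * t)) y.
Definition tbil (x : tens phi M) (y : tens phi N) : tens phi P :=
  tlift (fun m s => inner m s y) x.
Lemma tbil_inner_bal m s : balanced phi (fun n t => tpure phi (b m n) (s * t)).
Proof.
split=> [t n n'|n t t'|r n t] /=.
- by rewrite bilDr tpureDl.
- by rewrite mulrDr tpureDr.
- by rewrite bilZr tpure_bal mulrCA.
Qed.
Let innerD m s : {morph inner m s : x y / x + y}.
Proof. exact: tliftD (tbil_inner_bal m s). Qed.
Let innerE m s n t : inner m s (tpure phi n t) = tpure phi (b m n) (s * t).
Proof. exact: tliftE (tbil_inner_bal m s) _ _. Qed.
Lemma tbil_bal y : balanced phi (fun m s => inner m s y).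
Proof.
split=> [s m m'|m s s'|r m s].
- move: y; apply: (@tens_ext _ _ (inner (m + m') s)
    (fun y => inner m s y + inner m' s y)) => [|x x'|n t]; first exact: innerD.
    by rewrite !innerD addrACA.
  by rewrite !innerE bilDl tpureDl.
- move: y; apply: (@tens_ext _ _ (inner m (s + s'))
    (fun y => inner m s y + inner m s' y)) => [|x x'|n t]; first exact: innerD.
    by rewrite !innerD addrACA.
  by rewrite !innerE mulrDl tpureDr.
- move: y; apply: (@tens_ext _ _ (inner (r *: m) s)
    (inner m (phi r * s))) => [|x x'|n t]; try exact: innerD.
  by rewrite !innerE bilZl tpure_bal mulrA.
Qed.
Lemma tbilDl y : {morph tbil^~ y : x x' / x + x'}.
Proof. by move=> x x'; apply: (tliftD (tbil_bal y)). Qed.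
Lemma tbilE m s n t :
  tbil (tpure phi m s) (tpure phi n t) = tpure phi (b m n) (s * t).
Proof. by rewrite /tbil (tliftE (tbil_bal _)) innerE. Qed.
Lemma tbilDr x : {morph tbil x : y y' / y + y'}.
Proof.
move=> y y'; apply: (@tens_ext _ _ (tbil^~ (y + y')) (fun x => tbil x y + tbil x y')).
- exact: tbilDl.
- by move=> u v; rewrite !tbilDl addrACA.
- by move=> m s; rewrite /tbil !(tliftE (tbil_bal _)) innerD.
Qed.
Lemma tbil_linl y : linear (tbil^~ y).
Proof.
apply: tens_linear => [|t m s]; first exact: tbilDl.
apply: (@tens_ext _ _ (tbil (tpure phi m (t * s)))
          (fun y => t *: tbil (tpure phi m s) y)) => [|u v|n u].
- exact: tbilDr.
- by rewrite tbilDr scalerDr.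
- by rewrite !tbilE tpureZ mulrA.
Qed.
Lemma tbil_linr x : linear (tbil x).
Proof.
apply: tens_linear => [|t n u]; first exact: tbilDr.
apply: (@tens_ext _ _ (tbil^~ (tpure phi n (t * u)))
          (fun x => t *: tbil x (tpure phi n u))) => [|w v|m s].
- exact: tbilDl.
- by rewrite tbilDl scalerDr.
- by rewrite !tbilE tpureZ mulrCA.
Qed.
Definition tens_bil : bil (tens phi M) (tens phi N) (tens phi P) :=
  Bil _ tbil_linl tbil_linr.
Lemma tbilZl t x y : tbil (t *: x) y = t *: tbil x y.
Proof. exact: (bilZl tens_bil). Qed.
Lemma tbilZr t x y : tbil x (t *: y) = t *: tbil x y.
Proof. exact: (bilZr tens_bil). Qed.
End Tbil.

Section Thom.
Variables M N : lmodType R.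
Let h (f : hom M N) (s : S) : hom (tens phi M) (tens phi N) :=
  s *: Hom _ (tmap_linear f).
Definition thom : tens phi (hom M N) -> hom (tens phi M) (tens phi N) := tlift h.
Lemma thom_bal : balanced phi h.
Proof.
split=> [s f g|f s s'|r f s]; rewrite /h.
- rewrite -scalerDr; congr (_ *: _); apply: homP => x; move: x.
  apply: (@tens_ext _ _ (tmap (f + g)) (fun x => tmap f x + tmap g x)).
  + exact: tmapD.
  + by move=> x y; rewrite !tmapD addrACA.
  + by move=> m t; rewrite !tmapE /= tpureDl.
- by rewrite scalerDl.
- rewrite mulrC -scalerA; congr (_ *: _); apply: homP => x; move: x.
  apply: (@tens_ext _ _ (tmap (r *: f)) (fun x => phi r *: tmap f x)).
  + exact: tmapD.
  + by move=> x y; rewrite tmapD scalerDr.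
  + by move=> m t; rewrite !tmapE /= tpure_bal tpureZ.
Qed.
Lemma thomD : {morph thom : x y / x + y}. Proof. exact: tliftD thom_bal. Qed.
Lemma thomE f s : thom (tpure phi f s) = s *: Hom _ (tmap_linear f).
Proof. exact: tliftE thom_bal _ _. Qed.
Lemma thom_linear : linear thom.
Proof.
by apply: tens_linear thomD _ => t f s; rewrite !thomE scalerA.
Qed.
HB.instance Definition _ := GRing.isLinear.Build S _ _ *:%R thom thom_linear.
End Thom.

Section Tbc.
Variables (T : comPzRingType) (psi : {rmorphism S -> T}) (M : lmodType R).
Let inner (t : T) (x : tens phi M) : tens (psi \o phi) M :=
  tlift (fun m s => tpure (psi \o phi) m (psi s * t)) x.
Definition tbc (x : tens psi (tens phi M)) : tens (psi \o phi) M :=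
  tlift (fun y t => inner t y) x.
Definition tbcV (x : tens (psi \o phi) M) : tens psi (tens phi M) :=
  tlift (fun m t => tpure psi (tpure phi m 1) t) x.
Lemma tbc_inner_bal t :
  balanced phi (fun (m : M) s => tpure (psi \o phi) m (psi s * t)).
Proof.
split=> [s m m'|m s s'|r m s] /=.
- by rewrite tpureDl.
- by rewrite rmorphD mulrDl tpureDr.
- by rewrite tpure_bal /= rmorphM mulrA.
Qed.
Let innerD t : {morph inner t : x y / x + y}.
Proof. exact: tliftD (tbc_inner_bal t). Qed.
Let innerE t m s : inner t (tpure phi m s) = tpure (psi \o phi) m (psi s * t).
Proof. exact: tliftE (tbc_inner_bal t) _ _. Qed.
Lemma tbc_bal : balanced psi (fun y t => inner t y).
Proof.
split=> [t|x t t'|u x t]; first exact: innerD.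
- move: x; apply: tens_ext => [|x y|m s]; first exact: innerD.
    by rewrite !innerD addrACA.
  by rewrite !innerE mulrDr tpureDr.
- move: x; apply: (@tens_ext _ _ (fun x => inner t (u *: x))) => [x y||m s].
  + by rewrite scalerDr innerD.
  + exact: innerD.
  + by rewrite tpureZ !innerE rmorphM mulrCA mulrA.
Qed.
Lemma tbcD : {morph tbc : x y / x + y}. Proof. exact: tliftD tbc_bal. Qed.
Lemma tbcE m s t :
  tbc (tpure psi (tpure phi m s) t) = tpure (psi \o phi) m (psi s * t).
Proof. by rewrite /tbc (tliftE tbc_bal) innerE. Qed.
Lemma tbcV_bal :
  balanced (psi \o phi) (fun (m : M) t => tpure psi (tpure phi m 1) t).
Proof.
split=> [s m m'|m s s'|r m s] /=.
- by rewrite !tpureDl.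
- by rewrite tpureDr.
- by rewrite tpure_bal -tpureZ tpure_bal.
Qed.
Lemma tbcVD : {morph tbcV : x y / x + y}. Proof. exact: tliftD tbcV_bal. Qed.
Lemma tbcVE m t :
  tbcV (tpure (psi \o phi) m t) = tpure psi (tpure phi m 1) t.
Proof. exact: tliftE tbcV_bal _ _. Qed.
End Tbc.
End TensOps.

Section TensOps2.
Variables (R S : comPzRingType) (phi : {rmorphism R -> S}).
Variable M : lmodType R.

Section Tbc2.
Variables (T : comPzRingType) (psi : {rmorphism S -> T}).
Lemma tbcZ t (x : tens psi (tens phi M)) : tbc (t *: x) = t *: tbc x.
Proof.
move: x; apply: (@tens_ext _ _ _ _ _ (fun x => tbc (t *: x)) (fun x => t *: tbc x)).
- by move=> x y; rewrite scalerDr tbcD.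
- by move=> x y; rewrite tbcD scalerDr.
move=> y u; move: y.
apply: (@tens_ext _ _ _ _ _ (fun y => tbc (t *: tpure psi y u))
          (fun y => t *: tbc (tpure psi y u))).
- by move=> x y; rewrite tpureDl scalerDr tbcD.
- by move=> x y; rewrite tpureDl tbcD scalerDr.
by move=> m s; rewrite tpureZ !tbcE tpureZ mulrCA.
Qed.
Lemma tbcVZ t (x : tens (psi \o phi) M) : tbcV (t *: x) = t *: tbcV x.
Proof.
move: x; apply: (@tens_ext _ _ _ _ _ (fun x => tbcV (t *: x)) (fun x => t *: tbcV x)).
- by move=> x y; rewrite scalerDr tbcVD.
- by move=> x y; rewrite tbcVD scalerDr.
by move=> m s; rewrite tpureZ !tbcVE tpureZ.
Qed.
Lemma tbcK : cancel (@tbc _ _ phi T psi M) (@tbcV _ _ phi T psi M).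
Proof.
apply: (@tens_ext _ _ _ _ _ (fun x => tbcV (tbc x)) id) => [x y|//|y u].
  by rewrite tbcD tbcVD.
move: y; apply: (@tens_ext _ _ _ _ _ (fun y => tbcV (tbc (tpure psi y u)))
                  (fun y => tpure psi y u)).
- by move=> x y; rewrite tpureDl tbcD tbcVD.
- by move=> x y; rewrite tpureDl.
by move=> m s; rewrite tbcE tbcVE -tpure_bal tpureZ mulr1.
Qed.
Lemma tbcVK : cancel (@tbcV _ _ phi T psi M) (@tbc _ _ phi T psi M).
Proof.
apply: (@tens_ext _ _ _ _ _ (fun x => tbc (tbcV x)) id) => [x y|//|m u].
  by rewrite tbcVD tbcD.
by rewrite tbcVE tbcE rmorph1 mul1r.
Qed.
End Tbc2.

(* Only meaningful when g is a morphism of R-algebras (hg); the definition itself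
   does not depend on hg. *)
Section Tscal.
Variables (S' : comPzRingType) (phi' : {rmorphism R -> S'}).
Variables (g : {rmorphism S -> S'}) (hg : forall r, g (phi r) = phi' r).
Definition tscal : tens phi M -> tens phi' M :=
  tlift (fun m s => tpure phi' m (g s)).
Lemma tscal_bal : balanced phi (fun (m : M) s => tpure phi' m (g s)).
Proof.
split=> [s m m'|m s s'|r m s] /=.
- by rewrite tpureDl.
- by rewrite rmorphD tpureDr.
- by rewrite tpure_bal rmorphM hg.
Qed.
Lemma tscalD : {morph tscal : x y / x + y}. Proof. exact: tliftD tscal_bal. Qed.
Lemma tscal0 : tscal 0 = 0. Proof. exact: tlift0 tscal_bal. Qed.
Lemma tscalE m s : tscal (tpure phi m s) = tpure phi' m (g s).
Proof. exact: tliftE tscal_bal _ _. Qed.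
Lemma tscalZ t x : tscal (t *: x) = g t *: tscal x.
Proof.
move: x; apply: (@tens_ext _ _ _ _ _ (fun x => tscal (t *: x)) (fun x => g t *: tscal x)).
- by move=> x y; rewrite scalerDr tscalD.
- by move=> x y; rewrite tscalD scalerDr.
by move=> m s; rewrite tpureZ !tscalE tpureZ rmorphM.
Qed.
Lemma tscalN x : tscal (- x) = - tscal x.
Proof. by rewrite -!scaleN1r tscalZ rmorphN1. Qed.
End Tscal.
End TensOps2.
Arguments tscal {R S} phi {M S'} phi' g.

Section Tid.
Variables (R : comPzRingType) (M : lmodType R).
Definition tid : tens (idfun : {rmorphism R -> R}) M -> M :=
  tlift (fun (m : M) (r : R) => r *: m).
Lemma tid_bal : balanced idfun (fun (m : M) (r : R) => r *: m).
Proof.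
split=> [r m m'|m s s'|r m s] /=.
- by rewrite scalerDr.
- by rewrite scalerDl.
- by rewrite scalerA mulrC.
Qed.
Lemma tidD : {morph tid : x y / x + y}. Proof. exact: tliftD tid_bal. Qed.
Lemma tidE (m : M) (r : R) : tid (tpure idfun m r) = r *: m.
Proof. exact: tliftE tid_bal _ _. Qed.
Lemma tid_linear : linear tid.
Proof. by apply: tens_linear tidD _ => t m s; rewrite !tidE scalerA. Qed.
HB.instance Definition _ := GRing.isLinear.Build R _ _ *:%R tid tid_linear.
Lemma tidK x : tpure idfun (tid x) 1 = x.
Proof.
move: x; apply: (@tens_ext _ _ _ _ _ (fun x => tpure idfun (tid x) 1) id) => [x y|//|m r].
  by rewrite tidD tpureDl.
by rewrite tidE tpure_bal mulr1.
Qed.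
End Tid.

Section PolyLaw.
Variable R : comPzRingType.

Record polylaw (M N : lmodType R) := PolyLaw {
  pl_fun :> forall (S : comPzRingType) (phi : {rmorphism R -> S}),
    tens phi M -> tens phi N;
  pl_natural : forall (S S' : comPzRingType) (phi : {rmorphism R -> S})
    (phi' : {rmorphism R -> S'}) (g : {rmorphism S -> S'}),
    (forall r, g (phi r) = phi' r) ->
    forall x : tens phi M,
      tscal phi phi' g (@pl_fun S phi x) = @pl_fun S' phi' (tscal phi phi' g x) }.

Definition pl_eq (M N : lmodType R) (f g : polylaw M N) : Prop :=
  forall (S : comPzRingType) (phi : {rmorphism R -> S}) (x : tens phi M),
    f S phi x = g S phi x.

Definition homogeneous (M N : lmodType R) (d : nat) (f : polylaw M N) : Prop :=
  forall (S : comPzRingType) (phi : {rmorphism R -> S}) (s : S) (x : tens phi M),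
    f S phi (s *: x) = s ^+ d *: f S phi x.

Definition pl_eval (M N : lmodType R) (f : polylaw M N) (x : M) : N :=
  tid (f R idfun (tpure idfun x 1)).

Definition polar (M N : lmodType R) (f : polylaw M N) (x y : M) : N :=
  pl_eval f (x + y) - pl_eval f x - pl_eval f y.

Section Combinators.
Variables (M N P : lmodType R).

Program Definition pl_lin (f : {linear M -> N}) : polylaw M N :=
  @PolyLaw M N (fun S phi => tmap (phi := phi) f) _.
Next Obligation.
move: x; apply: (@tens_ext _ _ _ _ _ (fun x => tscal phi phi' g (tmap f x))
                   (fun x => tmap f (tscal phi phi' g x))) => [x y|x y|m s].
- by rewrite tmapD tscalD.
- by rewrite tscalD // tmapD.
- by rewrite tmapE !tscalE // tmapE.
Qed.

Program Definition pl_comp (f : polylaw N P) (h : polylaw M N) : polylaw M P :=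
  @PolyLaw M P (fun S phi x => f S phi (h S phi x)) _.
Next Obligation. by rewrite !(pl_natural _ H). Qed.

Program Definition pl_add (f h : polylaw M N) : polylaw M N :=
  @PolyLaw M N (fun S phi x => f S phi x + h S phi x) _.
Next Obligation. by rewrite tscalD // !(pl_natural _ H). Qed.

Program Definition pl_opp (f : polylaw M N) : polylaw M N :=
  @PolyLaw M N (fun S phi x => - f S phi x) _.
Next Obligation. by rewrite tscalN // !(pl_natural _ H). Qed.

Program Definition pl_scale (a : R) (f : polylaw M N) : polylaw M N :=
  @PolyLaw M N (fun S phi x => phi a *: f S phi x) _.
Next Obligation. by rewrite tscalZ // H !(pl_natural _ H). Qed.

Program Definition pl_sum (I : finType) (f : I -> polylaw M N) : polylaw M N :=
  @PolyLaw M N (fun S phi x => \sum_i f i S phi x) _.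
Next Obligation.
rewrite (big_morph _ (tscalD H) (tscal0 _ H)); apply: eq_bigr => i _.
exact: pl_natural.
Qed.
End Combinators.

Program Definition pl_bil (M N P Q : lmodType R) (b : bil N P Q)
    (f : polylaw M N) (h : polylaw M P) : polylaw M Q :=
  @PolyLaw M Q (fun S phi x => tbil b (f S phi x) (h S phi x)) _.
Next Obligation.
rewrite -!(pl_natural _ H); move: (f _ _ x) (h _ _ x) => y z; move: y.
apply: (@tens_ext _ _ _ _ _ (fun y => tscal phi phi' g (tbil b y z))
          (fun y => tbil b (tscal phi phi' g y) (tscal phi phi' g z))).
- by move=> u v; rewrite tbilDl tscalD.
- by move=> u v; rewrite tscalD // tbilDl.
move=> n s; move: z.
apply: (@tens_ext _ _ _ _ _ (fun z => tscal phi phi' g (tbil b _ z))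
          (fun z => tbil b _ (tscal phi phi' g z))).
- by move=> u v; rewrite tbilDr tscalD.
- by move=> u v; rewrite tscalD // tbilDr.
by move=> p t; rewrite tbilE !tscalE // tbilE rmorphM.
Qed.

Section Eval.
Variables (M N P Q : lmodType R).
Lemma pl_eval_lin (f : {linear M -> N}) x : pl_eval (pl_lin f) x = f x.
Proof. by rewrite /pl_eval /= tmapE tidE scale1r. Qed.
Lemma pl_eval_comp (f : polylaw N P) (h : polylaw M N) x :
  pl_eval (pl_comp f h) x = pl_eval f (pl_eval h x).
Proof. by rewrite /pl_eval /= tidK. Qed.
Lemma pl_eval_add (f h : polylaw M N) x :
  pl_eval (pl_add f h) x = pl_eval f x + pl_eval h x.
Proof. exact: tidD. Qed.
Lemma pl_eval_opp (f : polylaw M N) x : pl_eval (pl_opp f) x = - pl_eval f x.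
Proof. by rewrite /pl_eval /= linearN. Qed.
Lemma pl_eval_scale a (f : polylaw M N) x :
  pl_eval (pl_scale a f) x = a *: pl_eval f x.
Proof. by rewrite /pl_eval /= linearZ. Qed.
Lemma pl_eval_sum (I : finType) (f : I -> polylaw M N) x :
  pl_eval (pl_sum f) x = \sum_i pl_eval (f i) x.
Proof. by rewrite /pl_eval /= linear_sum. Qed.
Lemma pl_eval_bil (b : bil N P Q) (f : polylaw M N) (h : polylaw M P) x :
  pl_eval (pl_bil b f h) x = b (pl_eval f x) (pl_eval h x).
Proof.
rewrite /pl_eval /=; move: (f _ _ _) (h _ _ _) => y z.
by rewrite -(tidK y) -(tidK z) tbilE !tidE mulr1 !scale1r.
Qed.
End Eval.

Section Homogeneous.
Variables (M N P Q : lmodType R).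
Lemma homog_lin (f : {linear M -> N}) : homogeneous 1 (pl_lin f).
Proof. by move=> S phi s x; rewrite /= linearZ. Qed.
Lemma homog_comp (f : polylaw N P) (h : polylaw M N) d e :
  homogeneous d f -> homogeneous e h -> homogeneous (e * d) (pl_comp f h).
Proof. by move=> hf hh S phi s x; rewrite /= hh hf exprM. Qed.
Lemma homog_add (f h : polylaw M N) d :
  homogeneous d f -> homogeneous d h -> homogeneous d (pl_add f h).
Proof. by move=> hf hh S phi s x; rewrite /= hf hh scalerDr. Qed.
Lemma homog_opp (f : polylaw M N) d :
  homogeneous d f -> homogeneous d (pl_opp f).
Proof. by move=> hf S phi s x; rewrite /= hf scalerN. Qed.
Lemma homog_sum (I : finType) (f : I -> polylaw M N) d :
  (forall i, homogeneous d (f i)) -> homogeneous d (pl_sum f).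
Proof.
by move=> hf S phi s x; rewrite /= scaler_sumr; apply: eq_bigr => i _; apply: hf.
Qed.
Lemma homog_bil (b : bil N P Q) (f : polylaw M N) (h : polylaw M P) d e :
  homogeneous d f -> homogeneous e h -> homogeneous (d + e) (pl_bil b f h).
Proof.
by move=> hf hh S phi s x; rewrite /= hf hh exprD -scalerA tbilZl tbilZr.
Qed.
End Homogeneous.
End PolyLaw.

Lemma pl_pure (R S : comPzRingType) (phi : {rmorphism R -> S})
    (M N : lmodType R) (f : polylaw M N) (x : M) :
  f S phi (tpure phi x 1) = tpure phi (pl_eval f x) 1.
Proof.
have H r : phi ((idfun : {rmorphism R -> R}) r) = phi r by [].
rewrite -[in LHS](rmorph1 phi) -(tscalE H) -(pl_natural f H).
by rewrite -(tidK (f R idfun _)) tscalE // rmorph1.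
Qed.

Section Polar.
Variables (R : comPzRingType) (M N P Q : lmodType R).
Lemma polarC (f : polylaw M N) x y : polar f x y = polar f y x.
Proof. by rewrite /polar [y + x]addrC addrAC. Qed.
Lemma polar_add (f h : polylaw M N) x y :
  polar (pl_add f h) x y = polar f x y + polar h x y.
Proof. by rewrite /polar !pl_eval_add !opprD (addrACA (pl_eval f (x + y))) [LHS]addrACA. Qed.
Lemma polar_opp (f : polylaw M N) x y : polar (pl_opp f) x y = - polar f x y.
Proof. by rewrite /polar !pl_eval_opp !opprD. Qed.
Lemma polar_sum (I : finType) (f : I -> polylaw M N) x y :
  polar (pl_sum f) x y = \sum_i polar (f i) x y.
Proof. by rewrite /polar !pl_eval_sum !sumrB. Qed.
Lemma polar_linl (g : {linear N -> P}) (f : polylaw M N) x y :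
  polar (pl_comp (pl_lin g) f) x y = g (polar f x y).
Proof. by rewrite /polar !pl_eval_comp !pl_eval_lin !linearB. Qed.
Lemma polar_linr (f : polylaw N P) (g : {linear M -> N}) x y :
  polar (pl_comp f (pl_lin g)) x y = polar f (g x) (g y).
Proof. by rewrite /polar !pl_eval_comp !pl_eval_lin !linearD. Qed.
Lemma polar_bil (b : bil N P Q) (f : {linear M -> N}) (h : {linear M -> P}) x y :
  polar (pl_bil b (pl_lin f) (pl_lin h)) x y = b (f x) (h y) + b (f y) (h x).
Proof.
rewrite /polar !pl_eval_bil !pl_eval_lin !linearD bilDl !bilDr.
by rewrite [b (f x) (h x) + _]addrC [_ + _ + (_ + _)]addrAC addrK addrA addrK.
Qed.
Lemma homog_eval0 (f : polylaw M N) d : homogeneous d.+1 f -> pl_eval f 0 = 0.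
Proof.
move=> hf; rewrite /pl_eval -(scale0r (0 : M)) tpure_bal /= -tpureZ hf.
by rewrite exprS mul0r scale0r linear0.
Qed.
End Polar.

(* Scalar extension of a law along phi : R -> S: an S-algebra psi : S -> T is an
   R-algebra through psi \o phi, and (M (x)_R S) (x)_S T = M (x)_R T. *)
Section PolyLawBc.
Variables (R S : comPzRingType) (phi : {rmorphism R -> S}).
Variables (M N : lmodType R) (f : polylaw M N).

Program Definition pl_bc : polylaw (tens phi M) (tens phi N) :=
  @PolyLaw S (tens phi M) (tens phi N)
    (fun T psi x => tbcV (f T (psi \o phi) (tbc x))) _.
Next Obligation.
have H' r : g ((phi0 \o phi) r) = (phi' \o phi) r by rewrite /= H.
rename S0 into T, phi0 into psi, S' into T', phi' into psi'.
transitivity (tbcV (tscal (psi \o phi) (psi' \o phi) g (f T (psi \o phi) (tbc x)))).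
  move: (f _ _ _).
  apply: (@tens_ext _ _ _ _ _ (fun y => tscal psi psi' g (tbcV y))
    (fun y => tbcV (tscal (psi \o phi) (psi' \o phi) g y))) => [u v|u v|m t].
  - by rewrite tbcVD tscalD.
  - by rewrite tscalD // tbcVD.
  - by rewrite tbcVE !tscalE // tbcVE.
rewrite (pl_natural f H'); congr (tbcV (f _ _ _)).
move: x; apply: (@tens_ext _ _ _ _ _ (fun x => tscal _ _ g (tbc x))
  (fun x => tbc (tscal _ _ g x))) => [u v|u v|y t].
- by rewrite tbcD tscalD.
- by rewrite tscalD // tbcD.
move: y; apply: (@tens_ext _ _ _ _ _
  (fun y => tscal (psi \o phi) (psi' \o phi) g (tbc (tpure psi y t)))
  (fun y => tbc (tscal psi psi' g (tpure psi y t)))) => [u v|u v|m s].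
- by rewrite tpureDl tbcD tscalD.
- by rewrite tpureDl tscalD // tbcD.
- by rewrite tbcE !tscalE // tbcE rmorphM H.
Qed.

Lemma homog_bc d : homogeneous d f -> homogeneous d pl_bc.
Proof. by move=> hf T psi t x; rewrite /= tbcZ hf tbcVZ. Qed.

Lemma pl_eval_bc x : pl_eval pl_bc x = f S phi x.
Proof.
have H r : (idfun : {rmorphism S -> S}) ((idfun \o phi) r) = phi r by [].
transitivity (tscal (idfun \o phi) phi idfun
                (f S (idfun \o phi) (tbc (tpure idfun x 1)))).
  rewrite /pl_eval /=; move: (f _ _ _).
  apply: (@tens_ext _ _ _ _ _ (fun y => tid (tbcV y))
            (fun y => tscal (idfun \o phi) phi idfun y)) => [u v|u v|m t].
  - by rewrite tbcVD tidD.
  - by rewrite tscalD.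
  - by rewrite tbcVE tidE tpureZ mulr1 tscalE.
rewrite (pl_natural f H); congr (f _ _ _).
move: x; apply: (@tens_ext _ _ _ _ _ (fun x => tscal (idfun \o phi) phi idfun
  (tbc (tpure idfun x 1))) id) => [u v|//|m s].
- by rewrite tpureDl tbcD tscalD.
- by rewrite tbcE tscalE //= mulr1.
Qed.
End PolyLawBc.

Section Lin.
Variables (R : comPzRingType) (M N P : lmodType R).
Lemma lin_add (f g : M -> N) :
  linear f -> linear g -> linear (fun x => f x + g x).
Proof. by move=> lf lg a u v; rewrite lf lg scalerDr addrACA. Qed.
Lemma lin_opp (f : M -> N) : linear f -> linear (fun x => - f x).
Proof. by move=> lf a u v; rewrite lf opprD scalerN. Qed.
Lemma lin_pair (f : M -> N) (g : M -> P) :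
  linear f -> linear g -> linear (fun x => (f x, g x) : (N * P)%type).
Proof. by move=> lf lg a u v; rewrite lf lg. Qed.
Lemma lin_comp (f : N -> P) (g : M -> N) :
  linear f -> linear g -> linear (fun x => f (g x)).
Proof. by move=> lf lg a u v; rewrite lg lf. Qed.
Lemma lin_ffun (I : finType) (f : I -> M -> N) :
  (forall i, linear (f i)) -> linear (fun x => [ffun i => f i x]).
Proof. by move=> lf a u v; apply/ffunP => i; rewrite !ffunE lf. Qed.
End Lin.

Definition runit (R : comPzRingType) (a : R) : Prop := exists b, a * b = 1.

Record quad_alg (R : comPzRingType) := QuadAlg {
  qa_car :> lmodType R;
  qa_mul : bil qa_car qa_car qa_car;
  qa_one : qa_car;
  qa_norm : polylaw qa_car R^o;
  qa_mul1x : forall x, qa_mul qa_one x = x;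
  qa_mulx1 : forall x, qa_mul x qa_one = x;
  qa_norm_quad : homogeneous 2 qa_norm }.

(* Isomorphisms are required to preserve the norm as a law (for composition
   algebras of rank >= 2 this is automatic). *)
Definition qa_iso (R : comPzRingType) (C D : quad_alg R) (f : {linear C -> D}) : Prop :=
  [/\ bijective f,
      f (qa_one C) = qa_one D,
      forall x y, f (qa_mul C x y) = qa_mul D (f x) (f y)
    & pl_eq (pl_comp (qa_norm D) (pl_lin f)) (qa_norm C)].

Definition qa_isomorphic (R : comPzRingType) (C D : quad_alg R) : Prop :=
  exists f : {linear C -> D}, qa_iso f.

Section QuadAlgBc.
Variables (R S : comPzRingType) (phi : {rmorphism R -> S}) (C : quad_alg R).
Lemma qa_bc_mul1x x :
  tens_bil phi (qa_mul C) (tpure phi (qa_one C) 1) x = x.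
Proof.
move: x; apply: (@tens_ext _ _ _ _ _ (tbil (qa_mul C) (tpure phi (qa_one C) 1)) id).
- exact: tbilDr.
- by [].
- by move=> m s; rewrite tbilE qa_mul1x mul1r.
Qed.
Lemma qa_bc_mulx1 x :
  tens_bil phi (qa_mul C) x (tpure phi (qa_one C) 1) = x.
Proof.
move: x; apply: (@tens_ext _ _ _ _ _ ((tbil (qa_mul C))^~ (tpure phi (qa_one C) 1)) id).
- exact: tbilDl.
- by [].
- by move=> m s; rewrite tbilE qa_mulx1 mulr1.
Qed.
Definition scalar_law_bc (M : lmodType R) (f : polylaw M R^o) :
  polylaw (tens phi M) S^o := pl_comp (pl_lin (@tring _ _ phi)) (pl_bc phi f).
Lemma homog_scalar_bc (M : lmodType R) (f : polylaw M R^o) d :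
  homogeneous d f -> homogeneous d (scalar_law_bc f).
Proof.
move=> hf; have h1 := homog_bc (phi := phi) hf.
have h2 := homog_lin (@tring _ _ phi).
have := homog_comp h2 h1.
by rewrite muln1.
Qed.
Definition qa_bc : quad_alg S :=
  @QuadAlg S (tens phi C) (tens_bil phi (qa_mul C)) (tpure phi (qa_one C) 1)
    (scalar_law_bc (qa_norm C)) qa_bc_mul1x qa_bc_mulx1
    (homog_scalar_bc (@qa_norm_quad _ C)).
End QuadAlgBc.

Definition fin_generated (R : comPzRingType) (M : lmodType R) : Prop :=
  exists (n : nat) (e : 'I_n -> M),
    forall x, exists a : 'I_n -> R, x = \sum_i a i *: e i.

Definition projective (R : comPzRingType) (P : lmodType R) : Prop :=
  forall (M N : lmodType R) (p : {linear M -> N}) (f : {linear P -> N}),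
    (forall y, exists x, p x = y) ->
    exists h : {linear P -> M}, forall x, p (h x) = f x.

(* The last two fields say that x |-> n_C(x, -) is a well-defined bijection
   C -> C^*; it is R-linear because n_C(-, -) is symmetric. *)
Record composition_axioms (R : comPzRingType) (C : quad_alg R) : Prop :=
  CompositionAxioms {
    comp_fin_generated : fin_generated C;
    comp_projective : projective C;
    comp_normM : forall x y,
      pl_eval (qa_norm C) (qa_mul C x y) =
      (pl_eval (qa_norm C) x : R) * (pl_eval (qa_norm C) y : R);
    comp_norm1 : pl_eval (qa_norm C) (qa_one C) = 1 :> R;
    comp_polar_linear : forall x, linear (polar (qa_norm C) x);
    comp_polar_bij : forall l : {linear C -> R^o},
      exists! x, forall y, polar (qa_norm C) x y = l y }.

Record comp_alg (R : comPzRingType) := CompAlg {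
  ca_alg :> quad_alg R;
  ca_axioms : composition_axioms ca_alg }.

Section SplitModels.
Variable R : comPzRingType.

Definition pl_id (M : lmodType R) : polylaw M M := pl_lin (homid M).

Lemma homog_mul (M : lmodType R) (f h : polylaw M R^o) :
  homogeneous 1 f -> homogeneous 1 h -> homogeneous 2 (pl_bil (mul_bil R) f h).
Proof. by move=> hf hh; apply: (homog_bil _ hf hh). Qed.

Definition base_norm : polylaw R^o R^o :=
  pl_bil (mul_bil R) (pl_id R^o) (pl_id R^o).
Lemma base_norm_quad : homogeneous 2 base_norm.
Proof. by apply: homog_mul; apply: homog_lin. Qed.
Definition base_alg : quad_alg R :=
  @QuadAlg R R^o (mul_bil R) (1 : R) base_norm (@mul1r R) (@mulr1 R) base_norm_quad.

Definition fst_hom (M N : lmodType R) : hom (M * N)%type M.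
Proof. by exists fst. Defined.
Definition snd_hom (M N : lmodType R) : hom (M * N)%type N.
Proof. by exists snd. Defined.
Definition pair_mul (x y : R^o * R^o) : R^o * R^o :=
  (mul_bil R x.1 y.1, mul_bil R x.2 y.2).
Lemma pair_mul_linl y : linear (pair_mul^~ y).
Proof.
apply: lin_pair => a u v.
  exact: bil_linl (mul_bil R) y.1 a u.1 v.1.
exact: bil_linl (mul_bil R) y.2 a u.2 v.2.
Qed.
Lemma pair_mul_linr x : linear (pair_mul x).
Proof.
apply: lin_pair => a u v.
  exact: bil_linr (mul_bil R) x.1 a u.1 v.1.
exact: bil_linr (mul_bil R) x.2 a u.2 v.2.
Qed.
Lemma pair_mul1x x : pair_mul (1 : R, 1 : R) x = x.
Proof. by case: x => a b; rewrite /pair_mul /= !mul1r. Qed.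
Lemma pair_mulx1 x : pair_mul x (1 : R, 1 : R) = x.
Proof. by case: x => a b; rewrite /pair_mul /= !mulr1. Qed.
Definition pair_norm : polylaw (R^o * R^o)%type R^o :=
  pl_bil (mul_bil R) (pl_lin (fst_hom R^o R^o)) (pl_lin (snd_hom R^o R^o)).
Lemma pair_norm_quad : homogeneous 2 pair_norm.
Proof. by apply: homog_mul; apply: homog_lin. Qed.
Definition pair_alg : quad_alg R :=
  @QuadAlg R (R^o * R^o)%type (Bil _ pair_mul_linl pair_mul_linr)
    (1 : R, 1 : R) pair_norm pair_mul1x pair_mulx1 pair_norm_quad.

Definition entry_hom (i j : 'I_2) : hom 'M[R]_2 R^o.
Proof. by exists (fun A : 'M[R]_2 => (A i j : R^o)) => a A B; rewrite !mxE. Defined.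
Lemma mat2_mul_linl (B : 'M[R]_2) : linear (mulmx^~ B : 'M[R]_2 -> 'M[R]_2).
Proof. by move=> a u v; rewrite mulmxDl scalemxAl. Qed.
Lemma mat2_mul_linr (A : 'M[R]_2) : linear (mulmx A : 'M[R]_2 -> 'M[R]_2).
Proof. by move=> a u v; rewrite mulmxDr scalemxAr. Qed.
Definition mat2_norm : polylaw 'M[R]_2 R^o :=
  pl_add (pl_bil (mul_bil R) (pl_lin (entry_hom 0 0)) (pl_lin (entry_hom 1 1)))
    (pl_opp (pl_bil (mul_bil R) (pl_lin (entry_hom 0 1)) (pl_lin (entry_hom 1 0)))).
Lemma mat2_norm_quad : homogeneous 2 mat2_norm.
Proof.
apply: homog_add; last apply: homog_opp.
  by apply: homog_mul; apply: homog_lin.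
by apply: homog_mul; apply: homog_lin.
Qed.
Lemma mat2_norm_det A : pl_eval mat2_norm A = \det A :> R.
Proof.
rewrite pl_eval_add pl_eval_opp !pl_eval_bil !pl_eval_lin /=.
rewrite (expand_det_row _ 0) !big_ord_recl big_ord0 addr0 /cofactor /=.
rewrite !det_mx11 !mxE /= expr0 expr1 mul1r mulN1r mulrN.
by congr (A 0 _ * A _ _ - A _ _ * A _ _); apply: val_inj.
Qed.
Definition mat2_alg : quad_alg R :=
  @QuadAlg R 'M[R]_2 (Bil _ mat2_mul_linl mat2_mul_linr) 1%:M mat2_norm
    (@mul1mx R 2 2) (@mulmx1 R 2 2) mat2_norm_quad.

(* Zor(R); ((alpha1, alpha2), (u, x)) is the matrix (alpha1 u; x alpha2) *)
Definition dot (u v : 'rV[R]_3) : R^o := \sum_i u 0 i * v 0 i.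
Definition cross (u v : 'rV[R]_3) : 'rV[R]_3 :=
  \row_i (u 0 (i + 1) * v 0 (i + 2) - u 0 (i + 2) * v 0 (i + 1)).
Lemma dot_linl v : linear (dot^~ v).
Proof.
move=> a u w; rewrite /dot [in RHS]/GRing.scale /= mulr_sumr -big_split.
by apply: eq_bigr => i _; rewrite !mxE mulrDl mulrA.
Qed.
Lemma dot_linr u : linear (dot u).
Proof.
move=> a v w; rewrite /dot [in RHS]/GRing.scale /= mulr_sumr -big_split.
by apply: eq_bigr => i _; rewrite !mxE mulrDr mulrCA.
Qed.
Definition dot_bil : bil 'rV[R]_3 'rV[R]_3 R^o := Bil _ dot_linl dot_linr.
Lemma cross_linl v : linear (cross^~ v).
Proof.
move=> a u w; apply/rowP => i; rewrite /cross !mxE mulrDl [in X in _ - X]mulrDl.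
by rewrite -!mulrA opprD addrACA -mulrBr.
Qed.
Lemma cross_linr u : linear (cross u).
Proof.
move=> a v w; apply/rowP => i; rewrite /cross !mxE mulrDr [in X in _ - X]mulrDr.
by rewrite !(mulrCA _ a) opprD addrACA -mulrBr.
Qed.
Definition cross_bil : bil 'rV[R]_3 'rV[R]_3 'rV[R]_3 :=
  Bil _ cross_linl cross_linr.

Definition zorn : lmodType R := ((R^o * R^o) * ('rV[R]_3 * 'rV[R]_3))%type.
Definition zorn_mul (p q : zorn) : zorn :=
  ((p.1.1 * q.1.1 - dot p.2.1 q.2.2, - dot p.2.2 q.2.1 + p.1.2 * q.1.2),
   ((p.1.1 : R) *: q.2.1 + (q.1.2 : R) *: p.2.1 + cross p.2.2 q.2.2,
    (q.1.1 : R) *: p.2.2 + (p.1.2 : R) *: q.2.2 + cross p.2.1 q.2.1)).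
Definition zorn_one : zorn := ((1 : R, 1 : R), (0, 0)).
Definition zorn_a1 : hom zorn R^o. Proof. by exists (fun p => p.1.1). Defined.
Definition zorn_a2 : hom zorn R^o. Proof. by exists (fun p => p.1.2). Defined.
Definition zorn_u : hom zorn 'rV[R]_3. Proof. by exists (fun p => p.2.1). Defined.
Definition zorn_x : hom zorn 'rV[R]_3. Proof. by exists (fun p => p.2.2). Defined.
Lemma zorn_mul_linl q : linear (zorn_mul^~ q).
Proof.
apply: lin_pair; apply: lin_pair.
- apply: lin_add; last apply: lin_opp.
    by move=> a p p'; apply: (bil_linl (mul_bil R) q.1.1 a p.1.1 p'.1.1).
  by move=> a p p'; apply: (dot_linl q.2.2 a p.2.1 p'.2.1).
- apply: lin_add; first apply: lin_opp.
    by move=> a p p'; apply: (dot_linl q.2.1 a p.2.2 p'.2.2).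
  by move=> a p p'; apply: (bil_linl (mul_bil R) q.1.2 a p.1.2 p'.1.2).
- apply: lin_add; first apply: lin_add.
  + by move=> a p p'; apply: (bil_linl (scale_bil _) q.2.1 a p.1.1 p'.1.1).
  + by move=> a p p'; apply: (bil_linr (scale_bil _) q.1.2 a p.2.1 p'.2.1).
  + by move=> a p p'; apply: (cross_linl q.2.2 a p.2.2 p'.2.2).
- apply: lin_add; first apply: lin_add.
  + by move=> a p p'; apply: (bil_linr (scale_bil _) q.1.1 a p.2.2 p'.2.2).
  + by move=> a p p'; apply: (bil_linl (scale_bil _) q.2.2 a p.1.2 p'.1.2).
  + by move=> a p p'; apply: (cross_linl q.2.1 a p.2.1 p'.2.1).
Qed.
Lemma zorn_mul_linr p : linear (zorn_mul p).
Proof.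
apply: lin_pair; apply: lin_pair.
- apply: lin_add; last apply: lin_opp.
    by move=> a q q'; apply: (bil_linr (mul_bil R) p.1.1 a q.1.1 q'.1.1).
  by move=> a q q'; apply: (dot_linr p.2.1 a q.2.2 q'.2.2).
- apply: lin_add; first apply: lin_opp.
    by move=> a q q'; apply: (dot_linr p.2.2 a q.2.1 q'.2.1).
  by move=> a q q'; apply: (bil_linr (mul_bil R) p.1.2 a q.1.2 q'.1.2).
- apply: lin_add; first apply: lin_add.
  + by move=> a q q'; apply: (bil_linr (scale_bil _) p.1.1 a q.2.1 q'.2.1).
  + by move=> a q q'; apply: (bil_linl (scale_bil _) p.2.1 a q.1.2 q'.1.2).
  + by move=> a q q'; apply: (cross_linr p.2.2 a q.2.2 q'.2.2).
- apply: lin_add; first apply: lin_add.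
  + by move=> a q q'; apply: (bil_linl (scale_bil _) p.2.2 a q.1.1 q'.1.1).
  + by move=> a q q'; apply: (bil_linr (scale_bil _) p.1.2 a q.2.2 q'.2.2).
  + by move=> a q q'; apply: (cross_linr p.2.1 a q.2.1 q'.2.1).
Qed.
Definition zorn_mul_bil : bil zorn zorn zorn := Bil _ zorn_mul_linl zorn_mul_linr.
Lemma zorn_mul1x p : zorn_mul zorn_one p = p.
Proof.
case: p => [[a b] [u x]]; rewrite /zorn_mul /zorn_one /=.
have d0 v : dot 0 v = 0 := bil0l dot_bil v.
have c0 v : cross 0 v = 0 := bil0l cross_bil v.
by rewrite !d0 !c0 !mul1r !scale1r !scaler0 oppr0 !addr0 !add0r.
Qed.
Lemma zorn_mulx1 p : zorn_mul p zorn_one = p.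
Proof.
case: p => [[a b] [u x]]; rewrite /zorn_mul /zorn_one /=.
have d0 v : dot v 0 = 0 := bil0r dot_bil v.
have c0 v : cross v 0 = 0 := bil0r cross_bil v.
by rewrite !d0 !c0 !mulr1 !scale1r !scaler0 oppr0 !addr0 !add0r.
Qed.
Definition zorn_norm : polylaw zorn R^o :=
  pl_add (pl_bil (mul_bil R) (pl_lin zorn_a1) (pl_lin zorn_a2))
    (pl_bil dot_bil (pl_lin zorn_u) (pl_lin zorn_x)).
Lemma zorn_norm_quad : homogeneous 2 zorn_norm.
Proof.
have h1 (M : lmodType R) (f : {linear zorn -> M}) := homog_lin f.
exact: (homog_add (homog_bil _ (h1 _ _) (h1 _ _)) (homog_bil _ (h1 _ _) (h1 _ _))).
Qed.
Definition zorn_alg : quad_alg R :=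
  @QuadAlg R zorn zorn_mul_bil zorn_one zorn_norm
    zorn_mul1x zorn_mulx1 zorn_norm_quad.
End SplitModels.

(* The component C_e of C over the factor R_e of R = R_0 x R_1 x R_2 x R_3 is
   C (x)_R R_e.  It has constant rank 2^e because the model it is isomorphic to
   does, so no rank condition is stated; some of the R_e may be zero. *)
Definition split_comp (R : comPzRingType) (C : quad_alg R) : Prop :=
  exists (R0 R1 R2 R3 : comPzRingType)
    (p0 : {rmorphism R -> R0}) (p1 : {rmorphism R -> R1})
    (p2 : {rmorphism R -> R2}) (p3 : {rmorphism R -> R3}),
    [/\ bijective (fun r => (p0 r, p1 r, p2 r, p3 r)),
        (runit (2%:R : R0) /\ qa_isomorphic (qa_bc p0 C) (base_alg R0))%type,
        qa_isomorphic (qa_bc p1 C) (pair_alg R1),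
        qa_isomorphic (qa_bc p2 C) (mat2_alg R2)
      & qa_isomorphic (qa_bc p3 C) (zorn_alg R3)].

Record pq_alg (R : comPzRingType) := PqAlg {
  pq_car :> lmodType R;
  pq_U : polylaw pq_car (hom pq_car pq_car);
  pq_one : pq_car;
  pq_U_quad : homogeneous 2 pq_U;
  pq_U1 : pl_eval pq_U pq_one = homid pq_car }.

Definition pq_op (R : comPzRingType) (J : pq_alg R) (x : J) : hom J J :=
  pl_eval (pq_U J) x.

Definition pq_invertible (R : comPzRingType) (J : pq_alg R) (x : J) : Prop :=
  bijective (pq_op x).

Definition pq_iso (R : comPzRingType) (J J' : pq_alg R) (f : {linear J -> J'}) : Prop :=
  [/\ bijective f, f (pq_one J) = pq_one J'
    & forall x y, f (pq_op x y) = pq_op (f x) (f y)].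

Section PqBc.
Variables (R S : comPzRingType) (phi : {rmorphism R -> S}) (J : pq_alg R).
Definition pq_bc_U : polylaw (tens phi J) (hom (tens phi J) (tens phi J)) :=
  pl_comp (pl_lin (@thom R S phi J J)) (pl_bc phi (pq_U J)).
Lemma pq_bc_U_quad : homogeneous 2 pq_bc_U.
Proof.
have h1 := homog_bc (phi := phi) (@pq_U_quad _ J).
exact: (homog_comp (homog_lin (@thom R S phi J J)) h1).
Qed.
Lemma pq_bc_U1 : pl_eval pq_bc_U (tpure phi (pq_one J) 1) = homid _.
Proof.
rewrite pl_eval_comp pl_eval_lin pl_eval_bc pl_pure pq_U1 /= thomE scale1r.
apply: homP; apply: (@tens_ext _ _ _ _ _ (tmap (homid J)) id) => [||m s] //.
  exact: tmapD.
by rewrite tmapE.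
Qed.
Definition pq_bc : pq_alg S :=
  @PqAlg S (tens phi J) pq_bc_U (tpure phi (pq_one J) 1) pq_bc_U_quad pq_bc_U1.
End PqBc.

Section Her3.
Variables (R : comPzRingType) (C : comp_alg R).
Let n := qa_norm C.
Let mulC := qa_mul C.

Lemma comp_polar_linl y : linear ((polar n)^~ y).
Proof.
move=> a u v /=; rewrite !(polarC n _ y).
exact: (comp_polar_linear (ca_axioms C)).
Qed.
Definition comp_polar : bil C C R^o :=
  Bil _ comp_polar_linl (comp_polar_linear (ca_axioms C)).

Definition comp_tr : hom C R^o := Hom _ (bil_linl comp_polar (qa_one C)).
Lemma comp_conj_linear : linear (fun x => (comp_tr x : R) *: qa_one C - x).
Proof.
apply: lin_add; last exact: lin_opp.
exact: (lin_comp (bil_linl (scale_bil C) (qa_one C)) (@hom_linear _ _ _ comp_tr)).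
Qed.
Definition comp_conj : hom C C := Hom _ comp_conj_linear.

(* The Hermitian matrix with coordinates (alpha_i, c_i) is represented by
   these coordinates; indices in Z/3 are shifted by one: 0, 1, 2 here are the
   usual 1, 2, 3. *)
Definition her : lmodType R := ({ffun 'I_3 -> R^o} * {ffun 'I_3 -> C})%type.

Definition her_a (i : 'I_3) : hom her R^o.
Proof. by exists (fun x : her => x.1 i) => a u v; rewrite !ffunE. Defined.
Definition her_c (i : 'I_3) : hom her C.
Proof. by exists (fun x : her => x.2 i) => a u v; rewrite !ffunE. Defined.
Definition her_in_a (i : 'I_3) : hom R^o her.
Proof.
exists (fun r => ([ffun j => if j == i then r else 0], 0)) => a u v.
congr pair => /=; last by rewrite scaler0 addr0.
by apply/ffunP => j; rewrite !ffunE; case: eqP; rewrite ?scaler0 ?addr0.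
Defined.
Definition her_in_c (i : 'I_3) : hom C her.
Proof.
exists (fun c => (0, [ffun j => if j == i then c else 0])) => a u v.
congr pair => /=; first by rewrite scaler0 addr0.
by apply/ffunP => j; rewrite !ffunE; case: eqP; rewrite ?scaler0 ?addr0.
Defined.
Definition her_one : her := ([ffun => 1 : R], 0).

Let A i := pl_lin (her_a i).
Let K i := pl_lin (her_c i).

Definition sharp_a (i : 'I_3) : polylaw her R^o :=
  pl_add (pl_bil (mul_bil R) (A (i + 1)) (A (i + 2)))
    (pl_opp (pl_comp n (K i))).
Definition sharp_c (i : 'I_3) : polylaw her C :=
  pl_add (pl_opp (pl_bil (scale_bil C) (A i) (K i)))
    (pl_comp (pl_lin comp_conj) (pl_bil mulC (K (i + 1)) (K (i + 2)))).
Definition her_sharp : polylaw her her :=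
  pl_add (pl_sum (fun i => pl_comp (pl_lin (her_in_a i)) (sharp_a i)))
    (pl_sum (fun i => pl_comp (pl_lin (her_in_c i)) (sharp_c i))).

Lemma her_of_coords (f : 'I_3 -> R^o) (g : 'I_3 -> C) :
  \sum_i her_in_a i (f i) + \sum_i her_in_c i (g i) = (finfun f, finfun g).
Proof.
have sa i : her_a i (\sum_i her_in_a i (f i)) = f i.
  rewrite linear_sum (bigD1 i) //= big1.
    by rewrite !ffunE eqxx addr0.
  by move=> j ji; rewrite !ffunE eq_sym (negbTE ji).
have sc i : her_c i (\sum_i her_in_c i (g i)) = g i.
  rewrite linear_sum (bigD1 i) //= big1.
    by rewrite !ffunE eqxx addr0.
  by move=> j ji; rewrite !ffunE eq_sym (negbTE ji).
have sa0 : (\sum_i her_in_a i (f i)).2 = 0.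
  apply: (big_ind (fun x : her => x.2 = 0)) => //= x y ex ey.
  by rewrite -[LHS]/(x.2 + y.2) ex ey addr0.
have sc0 : (\sum_i her_in_c i (g i)).1 = 0.
  apply: (big_ind (fun x : her => x.1 = 0)) => //= x y ex ey.
  by rewrite -[LHS]/(x.1 + y.1) ex ey addr0.
rewrite -[LHS]/(_.1 + _.1, _.2 + _.2) sa0 sc0 addr0 add0r.
by congr pair; apply/ffunP => i; rewrite ffunE; [exact: sa|exact: sc].
Qed.

Lemma her_sharpE (x : her) :
  pl_eval her_sharp x =
  ([ffun i => (x.1 (i + 1) : R) * x.1 (i + 2) - pl_eval n (x.2 i)],
   [ffun i => - ((x.1 i : R) *: x.2 i)
              + comp_conj (qa_mul C (x.2 (i + 1)) (x.2 (i + 2)))]).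
Proof.
rewrite pl_eval_add !pl_eval_sum -her_of_coords.
congr (_ + _); apply: eq_bigr => i _; rewrite pl_eval_comp pl_eval_lin;
  congr (_ _ _).
- by rewrite pl_eval_add pl_eval_opp pl_eval_bil pl_eval_comp !pl_eval_lin.
- rewrite pl_eval_add pl_eval_opp pl_eval_comp !pl_eval_bil !pl_eval_lin.
  by [].
Qed.

Lemma her_sharp_quad : homogeneous 2 her_sharp.
Proof.
have h1 (M : lmodType R) (f : {linear her -> M}) := homog_lin f.
apply: homog_add; apply: homog_sum => i.
- apply: (homog_comp (homog_lin _) (e := 2)); apply: homog_add.
    exact: (homog_bil _ (h1 _ _) (h1 _ _)).
  apply: homog_opp; exact: (homog_comp (@qa_norm_quad _ C) (h1 _ _)).
- apply: (homog_comp (homog_lin _) (e := 2)); apply: homog_add.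
    apply: homog_opp; exact: (homog_bil _ (h1 _ _) (h1 _ _)).
  exact: (homog_comp (homog_lin _) (homog_bil _ (h1 _ _) (h1 _ _))).
Qed.

Definition her_cross (x y : her) : her := polar her_sharp x y.

Lemma her_crossE (x y : her) :
  her_cross x y =
  ([ffun i => ((x.1 (i + 1) : R) * y.1 (i + 2) + (y.1 (i + 1) : R) * x.1 (i + 2))
              - comp_polar (x.2 i) (y.2 i)],
   [ffun i => - ((x.1 i : R) *: y.2 i + (y.1 i : R) *: x.2 i)
              + comp_conj (qa_mul C (x.2 (i + 1)) (y.2 (i + 2)) +
                           qa_mul C (y.2 (i + 1)) (x.2 (i + 2)))]).
Proof.
rewrite /her_cross polar_add !polar_sum -her_of_coords.
congr (_ + _); apply: eq_bigr => i _; rewrite polar_linl; congr (_ _ _).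
- by rewrite polar_add polar_opp polar_linr polar_bil.
- by rewrite polar_add polar_opp polar_linl !polar_bil.
Qed.

Lemma her_cross_linr x : linear (her_cross x).
Proof.
have la i : linear (fun y : her => y.1 i) := @hom_linear _ _ _ (her_a i).
have lc i : linear (fun y : her => y.2 i) := @hom_linear _ _ _ (her_c i).
move=> a u v; rewrite !her_crossE; move: a u v.
apply: lin_pair; apply: lin_ffun => i.
- apply: lin_add; first apply: lin_add; last apply: lin_opp.
  + exact: (lin_comp (bil_linr (mul_bil R) (x.1 (i + 1))) (la _)).
  + exact: (lin_comp (bil_linl (mul_bil R) (x.1 (i + 2))) (la _)).
  + exact: (lin_comp (bil_linr comp_polar (x.2 i)) (lc _)).
- apply: lin_add; first (apply: lin_opp; apply: lin_add).
  + exact: (lin_comp (bil_linr (scale_bil C) (x.1 i)) (lc _)).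
  + exact: (lin_comp (bil_linl (scale_bil C) (x.2 i)) (la _)).
  + apply: (lin_comp (@hom_linear _ _ _ comp_conj)); apply: lin_add.
    * exact: (lin_comp (bil_linr mulC (x.2 (i + 1))) (lc _)).
    * exact: (lin_comp (bil_linl mulC (x.2 (i + 2))) (lc _)).
Qed.
Lemma her_cross_linl y : linear (her_cross^~ y).
Proof.
move=> a u v /=; rewrite /her_cross !(polarC _ _ y); exact: her_cross_linr.
Qed.

Definition her_T (x y : her) : R :=
  \sum_i ((x.1 i : R) * y.1 i + polar n (x.2 i) (y.2 i)).
Lemma lin_sum (M N : lmodType R) (I : finType) (f : I -> M -> N) :
  (forall i, linear (f i)) -> linear (fun x => \sum_i f i x).
Proof.
move=> lf a u v; rewrite scaler_sumr -big_split.
by apply: eq_bigr => i _; rewrite lf.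
Qed.
Lemma her_T_linr x : linear (her_T x : her -> R^o).
Proof.
apply: lin_sum => i; apply: lin_add.
  exact: (lin_comp (bil_linr (mul_bil R) (x.1 i)) (@hom_linear _ _ _ (her_a i))).
exact: (lin_comp (bil_linr comp_polar (x.2 i)) (@hom_linear _ _ _ (her_c i))).
Qed.
Lemma her_T_linl y : linear (her_T^~ y : her -> R^o).
Proof.
apply: lin_sum => i; apply: lin_add.
  exact: (lin_comp (bil_linl (mul_bil R) (y.1 i)) (@hom_linear _ _ _ (her_a i))).
exact: (lin_comp (bil_linl comp_polar (y.2 i)) (@hom_linear _ _ _ (her_c i))).
Qed.

Definition her_Tx (x x' : her) : hom her her :=
  Hom (fun y => her_T x y *: x') (lin_comp (bil_linl (scale_bil her) x') (her_T_linr x)).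
Lemma her_Tx_linl x' : linear (her_Tx^~ x').
Proof.
move=> a u v; apply: homP => y.
exact: (lin_comp (bil_linl (scale_bil her) x') (her_T_linl y)).
Qed.
Lemma her_Tx_linr x : linear (her_Tx x).
Proof.
by move=> a u v; apply: homP => y; apply: (bil_linr (scale_bil her) (her_T x y)).
Qed.
Definition her_cross_op (z : her) : hom her her := Hom _ (her_cross_linr z).
Lemma her_cross_op_linear : linear her_cross_op.
Proof. by move=> a u v; apply: homP => y; apply: her_cross_linl. Qed.

Definition her_U : polylaw her (hom her her) :=
  pl_add (pl_bil (Bil _ her_Tx_linl her_Tx_linr) (pl_id her) (pl_id her))
    (pl_opp (pl_comp (pl_lin (Hom _ her_cross_op_linear)) her_sharp)).

Lemma her_UE (x y : her) :
  pl_eval her_U x y = her_T x y *: x - her_cross (pl_eval her_sharp x) y.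
Proof.
by rewrite pl_eval_add pl_eval_bil pl_eval_opp pl_eval_comp !pl_eval_lin.
Qed.

Lemma her_U_quad : homogeneous 2 her_U.
Proof.
have h1 (M : lmodType R) (f : {linear her -> M}) := homog_lin f.
apply: homog_add; first exact: (homog_bil _ (h1 _ _) (h1 _ _)).
apply: homog_opp.
exact: (homog_comp (h1 _ _) her_sharp_quad).
Qed.

Lemma her_sharp1 : pl_eval her_sharp her_one = her_one.
Proof.
have e1 : her_one.1 = [ffun => 1 : R] by [].
have e2 : her_one.2 = 0 by [].
rewrite her_sharpE e1 e2; congr pair; apply/ffunP => i; rewrite !ffunE.
  by rewrite mul1r (homog_eval0 (@qa_norm_quad _ C)) subr0.
have conj0 : comp_conj 0 = 0 by exact: (linear0 comp_conj).
by rewrite scaler0 oppr0 bil0l conj0 addr0.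
Qed.

Lemma ord3_sum (f : 'I_3 -> R) (i : 'I_3) :
  \sum_j f j = f i + (f (i + 1) + f (i + 2)).
Proof.
rewrite (bigD1 i) //=; congr (_ + _).
rewrite (bigD1 (i + 1)) /=; last by case: i => -[|[|[]]].
rewrite (bigD1 (i + 2)) /=; last by case: i => -[|[|[]]].
rewrite big1 ?addr0 // => j.
by case: i => -[|[|[|//]]] ?; case: j => -[|[|[|//]]].
Qed.

Lemma her_U1 : pl_eval her_U her_one = homid her.
Proof.
have e1 : her_one.1 = [ffun => 1 : R] by [].
have e2 : her_one.2 = 0 by [].
have p0 c : polar n 0 c = 0 := bil0l comp_polar c.
have conj0 : comp_conj 0 = 0 by exact: (linear0 comp_conj).
have e (x y : her) : x - y = (x.1 - y.1, x.2 - y.2) by [].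
apply: homP => y; rewrite her_UE her_sharp1 her_crossE e [(_ *: _).1]/(_ *: her_one.1) [(_ *: _).2]/(_ *: her_one.2) /her_T e1 e2.
rewrite /homid; case: (y) => b d; congr pair; apply/ffunP => i; rewrite !ffunE.
- rewrite (ord3_sum _ i) !ffunE !p0 (bil0l comp_polar) !mul1r !addr0 !mulr1 subr0.
  apply: etrans (congr1 (fun z : R => z - _) (mulr1 _)) _.
  by rewrite [X in _ - X]addrC addrK.
- rewrite scaler0 sub0r !scale1r !scaler0 bil0l bil0r !addr0 conj0 addr0 opprK.
  by [].
Qed.
Definition her3 : pq_alg R :=
  @PqAlg R her her_U her_one her_U_quad her_U1.

Definition her_norm : polylaw her R^o :=
  pl_add
    (pl_add
       (pl_bil (mul_bil R) (pl_bil (mul_bil R) (A 0) (A 1)) (A 2))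
       (pl_opp (pl_sum (fun i => pl_bil (mul_bil R) (A i) (pl_comp n (K i))))))
    (pl_comp (pl_lin comp_tr)
       (pl_bil mulC (pl_bil mulC (K 0) (K 1)) (K 2))).

Lemma her_normE (x : her) :
  pl_eval her_norm x =
  (x.1 0 : R) * x.1 1 * x.1 2 - \sum_i (x.1 i : R) * pl_eval n (x.2 i)
  + comp_tr (qa_mul C (qa_mul C (x.2 0) (x.2 1)) (x.2 2)) :> R.
Proof.
rewrite pl_eval_add pl_eval_add pl_eval_opp pl_eval_comp pl_eval_sum.
rewrite !pl_eval_bil !pl_eval_lin; congr (_ - _ + _).
by apply: eq_bigr => i _; rewrite pl_eval_bil pl_eval_comp !pl_eval_lin.
Qed.

Lemma her_norm_cubic : homogeneous 3 her_norm.
Proof.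
have hA i : homogeneous 1 (A i) by apply: homog_lin.
have hK i : homogeneous 1 (K i) by apply: homog_lin.
apply: homog_add; first apply: homog_add.
- exact: homog_bil (homog_bil _ (hA _) (hA _)) (hA _).
- apply: homog_opp; apply: homog_sum => i.
  exact: (homog_bil _ (hA _) (homog_comp (@qa_norm_quad _ C) (hK i))).
- apply: (homog_comp (homog_lin _) (e := 3)).
  exact: homog_bil (homog_bil _ (hK _) (hK _)) (hK _).
Qed.
End Her3.

Definition faithfully_flat (R S : comPzRingType) (phi : {rmorphism R -> S}) : Prop :=
  [/\ forall (M N : lmodType R) (f : {linear M -> N}),
        injective f -> injective (tmap (phi := phi) f)
    & forall M : lmodType R,
        (forall x : tens phi M, x = 0) -> forall m : M, m = 0].

Definition freudenthal (R : comPzRingType) (J : pq_alg R) : Prop :=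
  exists (S : comPzRingType) (phi : {rmorphism R -> S}) (C : comp_alg S)
    (f : {linear pq_bc phi J -> her3 C}),
    [/\ faithfully_flat phi, split_comp C & pq_iso f].

(* The norm of J is determined by this property (descent along phi), whatever
   the choice of S, C and f, hence the existential quantifier. *)
Definition freudenthal_norm (R : comPzRingType) (J : pq_alg R)
    (N : polylaw J R^o) : Prop :=
  [/\ homogeneous 3 N
    & exists (S : comPzRingType) (phi : {rmorphism R -> S}) (C : comp_alg S)
        (f : {linear pq_bc phi J -> her3 C}),
        [/\ faithfully_flat phi, split_comp C, pq_iso f
          & pl_eq (scalar_law_bc phi N) (pl_comp (her_norm C) (pl_lin f))]].

Definition similar_by (R : comPzRingType) (J : lmodType R) (N : polylaw J R^o) (a : R) : Prop :=
  exists f : {linear J -> J},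
    [/\ bijective f & pl_eq (pl_scale a N) (pl_comp N (pl_lin f))].

(* Main.v *)
Require Import Defs.
From HB Require Import structures.
From mathcomp Require Import all_boot all_order all_algebra.
From mathcomp Require Import generic_quotient boolp classical_sets ring.
Set Implicit Arguments. Unset Strict Implicit. Unset Printing Implicit Defensive.
Import GRing.Theory.
Local Open Scope ring_scope.

(** If [h] is a similarity of [N] with multiplier [a], then [x = h 1] has norm
    [a * N 1 = a]; conversely, if [x] is invertible of unit norm [a], then
    [N o U_x = a^2 N], while [N o (a id) = a^3 N] because [N] is cubic, so
    [a U_x^-1] is a similarity with multiplier [a].  Two facts are needed: an
    element of unit norm is invertible ([pq_norm_unit_invertible]), and
    [N (U_x y) = N(x)^2 N(y)] as laws in [y] ([pq_norm_U]).

    Both are identities about cubic Jordan algebras, proved in the 27-dimensional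
    split Albert algebra over an arbitrary commutative ring.  The adjoint
    identity [x## = N(x) x] and two of its linearizations are checked in
    coordinates; from these follow formally [U_x U_(x#) = U_(x#) U_x = N(x)^2]
    ([albert_UK], [albert_sharp_UK]) and [(U_x y)# = U_(x#) y#]
    ([albert_sharp_U]).  The norm identity has degree 9 and is not expanded: the
    difference [F] of its two sides is a cubic form in [y] which is additive,
    since both sides have the same polarizations, and which satisfies
    [F(y) y = 0], by the adjoint identity for [U_x y]; so [F] vanishes
    ([albert_norm_U]).

    All algebras are brought into this one.  The four split composition algebras
    embed into each other, up to the split octonions, compatibly with the norms as
    laws ([base_embeds], [pair_embeds], [mat2_embeds], [zorn_embeds]), which
    induces maps from the hermitian matrices to the split Albert algebra.  For a
    Freudenthal algebra split by [S], where [S] is the product of the [S_i] over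
    which the rank is constant, an equality in an [R]-algebra [T] can be checked
    in the algebras [T (x) S (x) S_i]: faithful flatness makes [T -> T (x) S]
    injective, and the idempotents of [S] do the rest ([vanishes_eq0]).
    Bijectivity of [U_x] descends as well ([ff_bij]). *)

(** * The split octonions in coordinates *)

Section Oct.
Variable k : comPzRingType.
(** The Zorn matrices [(oa u; x ob)], with the vectors [u] and [x] spelled out so
    that identities reduce to ring identities between named scalars. *)
Record oct := Oct { oa : k; ob : k; ou0 : k; ou1 : k; ou2 : k;
                    ox0 : k; ox1 : k; ox2 : k }.
HB.instance Definition _ := gen_eqMixin oct.
HB.instance Definition _ := gen_choiceMixin oct.
Definition oct_zero := Oct 0 0 0 0 0 0 0 0.
Definition oct_add p q := Oct (oa p + oa q) (ob p + ob q)
  (ou0 p + ou0 q) (ou1 p + ou1 q) (ou2 p + ou2 q)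
  (ox0 p + ox0 q) (ox1 p + ox1 q) (ox2 p + ox2 q).
Definition oct_scale (r : k) p := Oct (r * oa p) (r * ob p)
  (r * ou0 p) (r * ou1 p) (r * ou2 p) (r * ox0 p) (r * ox1 p) (r * ox2 p).
Definition oct_mul p q := Oct
  (oa p * oa q - (ou0 p * ox0 q + ou1 p * ox1 q + ou2 p * ox2 q))
  (ob p * ob q - (ox0 p * ou0 q + ox1 p * ou1 q + ox2 p * ou2 q))
  (oa p * ou0 q + ob q * ou0 p + (ox1 p * ox2 q - ox2 p * ox1 q))
  (oa p * ou1 q + ob q * ou1 p + (ox2 p * ox0 q - ox0 p * ox2 q))
  (oa p * ou2 q + ob q * ou2 p + (ox0 p * ox1 q - ox1 p * ox0 q))
  (oa q * ox0 p + ob p * ox0 q + (ou1 p * ou2 q - ou2 p * ou1 q))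
  (oa q * ox1 p + ob p * ox1 q + (ou2 p * ou0 q - ou0 p * ou2 q))
  (oa q * ox2 p + ob p * ox2 q + (ou0 p * ou1 q - ou1 p * ou0 q)).
Definition oct_one := Oct 1 1 0 0 0 0 0 0.
Definition oct_norm p : k :=
  oa p * ob p + (ou0 p * ox0 p + ou1 p * ox1 p + ou2 p * ox2 p).
Definition oct_polar p q : k :=
  oa p * ob q + oa q * ob p + (ou0 p * ox0 q + ou0 q * ox0 p
   + (ou1 p * ox1 q + ou1 q * ox1 p) + (ou2 p * ox2 q + ou2 q * ox2 p)).
Definition oct_tr p : k := oa p + ob p.
Definition oct_conj p :=
  Oct (ob p) (oa p) (- ou0 p) (- ou1 p) (- ou2 p) (- ox0 p) (- ox1 p) (- ox2 p).

Ltac oct_unfold_ring := repeat intro;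
  repeat match goal with p : oct |- _ => destruct p end;
  rewrite /oct_mul /oct_add /oct_scale /oct_conj /oct_norm /oct_polar /oct_tr
     /oct_one /oct_zero /=; try congr Oct; ring.
Fact oct_addA : associative oct_add. Proof. oct_unfold_ring. Qed.
Fact oct_addC : commutative oct_add. Proof. oct_unfold_ring. Qed.
Fact oct_add0 : left_id oct_zero oct_add. Proof. oct_unfold_ring. Qed.
Fact oct_addN : left_inverse oct_zero (oct_scale (-1)) oct_add.
Proof. oct_unfold_ring. Qed.
HB.instance Definition _ :=
  GRing.isZmodule.Build oct oct_addA oct_addC oct_add0 oct_addN.
Lemma oct_addE p q : p + q = oct_add p q. Proof. by []. Qed.
Lemma oct_oppE p : - p = oct_scale (-1) p. Proof. by []. Qed.
Fact oct_scaleA a b p : oct_scale a (oct_scale b p) = oct_scale (a * b) p.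
Proof. oct_unfold_ring. Qed.
Fact oct_scale1 : left_id 1 oct_scale. Proof. oct_unfold_ring. Qed.
Fact oct_scaleDr : right_distributive oct_scale +%R.
Proof. move=> a p q; rewrite !oct_addE; oct_unfold_ring. Qed.
Fact oct_scaleDl p : {morph oct_scale^~ p : a b / a + b}.
Proof. move=> a b; rewrite !oct_addE; oct_unfold_ring. Qed.
HB.instance Definition _ :=
  GRing.Zmodule_isLmodule.Build k oct oct_scaleA oct_scale1 oct_scaleDr oct_scaleDl.

Implicit Types p q r : oct.
Lemma oct_scaleE (a : k) p : a *: p = oct_scale a p. Proof. by []. Qed.
Ltac oct_ring := repeat intro;
  repeat match goal with p : oct |- _ => destruct p end;
  rewrite ?(oct_addE, oct_oppE, oct_scaleE);
  rewrite /oct_mul /oct_add /oct_scale /oct_conj /oct_norm /oct_polar /oct_tr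
     /oct_one /oct_zero /=; try congr Oct; ring.

Lemma oct_mulDl p q r : oct_mul (p + q) r = oct_mul p r + oct_mul q r.
Proof. oct_ring. Qed.
Lemma oct_mulDr r p q : oct_mul r (p + q) = oct_mul r p + oct_mul r q.
Proof. oct_ring. Qed.
Lemma oct_mulZZ (a b : k) p q : oct_mul (a *: p) (b *: q) = (a * b) *: oct_mul p q.
Proof. oct_ring. Qed.
Lemma oct_polarE p q : oct_polar p q = oct_norm (p + q) - oct_norm p - oct_norm q.
Proof. oct_ring. Qed.
Lemma oct_polar1 p : oct_polar p oct_one = oct_tr p.
Proof. oct_ring. Qed.
Lemma oct_conjE p : oct_conj p = oct_tr p *: oct_one - p.
Proof. oct_ring. Qed.
Lemma oct_trD p q : oct_tr (p + q) = oct_tr p + oct_tr q.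
Proof. oct_ring. Qed.
Lemma oct_trZ a p : oct_tr (a *: p) = a * oct_tr p.
Proof. oct_ring. Qed.
End Oct.

(** * The split Albert algebra *)

Section Albert.
Variable k : comPzRingType.
Local Notation oct := (oct k).
Local Notation oct_zero := (oct_zero k).
(** The hermitian 3 x 3 matrices over the split octonions: diagonal entries [ha],
    off-diagonal ones [hc]. *)
Record albert := Albert { ha0 : k; ha1 : k; ha2 : k; hc0 : oct; hc1 : oct; hc2 : oct }.
HB.instance Definition _ := gen_eqMixin albert.
HB.instance Definition _ := gen_choiceMixin albert.
Definition albert_zero := Albert 0 0 0 oct_zero oct_zero oct_zero.
Definition albert_add x y := Albert (ha0 x + ha0 y) (ha1 x + ha1 y) (ha2 x + ha2 y)
  (oct_add (hc0 x) (hc0 y)) (oct_add (hc1 x) (hc1 y)) (oct_add (hc2 x) (hc2 y)).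
Definition albert_scale r x := Albert (r * ha0 x) (r * ha1 x) (r * ha2 x)
  (oct_scale r (hc0 x)) (oct_scale r (hc1 x)) (oct_scale r (hc2 x)).
Definition albert_sharp x := Albert
  (ha1 x * ha2 x - oct_norm (hc0 x))
  (ha2 x * ha0 x - oct_norm (hc1 x))
  (ha0 x * ha1 x - oct_norm (hc2 x))
  (oct_add (oct_scale (- ha0 x) (hc0 x)) (oct_conj (oct_mul (hc1 x) (hc2 x))))
  (oct_add (oct_scale (- ha1 x) (hc1 x)) (oct_conj (oct_mul (hc2 x) (hc0 x))))
  (oct_add (oct_scale (- ha2 x) (hc2 x)) (oct_conj (oct_mul (hc0 x) (hc1 x)))).
Definition albert_norm x : k :=
  ha0 x * ha1 x * ha2 x - (ha0 x * oct_norm (hc0 x) + ha1 x * oct_norm (hc1 x)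
   + ha2 x * oct_norm (hc2 x)) + oct_tr (oct_mul (oct_mul (hc0 x) (hc1 x)) (hc2 x)).
Definition albert_T x y : k :=
  ha0 x * ha0 y + oct_polar (hc0 x) (hc0 y) + (ha1 x * ha1 y + oct_polar (hc1 x) (hc1 y))
  + (ha2 x * ha2 y + oct_polar (hc2 x) (hc2 y)).
Definition albert_cross x y := Albert
  (ha1 x * ha2 y + ha1 y * ha2 x - oct_polar (hc0 x) (hc0 y))
  (ha2 x * ha0 y + ha2 y * ha0 x - oct_polar (hc1 x) (hc1 y))
  (ha0 x * ha1 y + ha0 y * ha1 x - oct_polar (hc2 x) (hc2 y))
  (oct_add (oct_add (oct_scale (- ha0 x) (hc0 y)) (oct_scale (- ha0 y) (hc0 x)))
    (oct_conj (oct_add (oct_mul (hc1 x) (hc2 y)) (oct_mul (hc1 y) (hc2 x)))))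
  (oct_add (oct_add (oct_scale (- ha1 x) (hc1 y)) (oct_scale (- ha1 y) (hc1 x)))
    (oct_conj (oct_add (oct_mul (hc2 x) (hc0 y)) (oct_mul (hc2 y) (hc0 x)))))
  (oct_add (oct_add (oct_scale (- ha2 x) (hc2 y)) (oct_scale (- ha2 y) (hc2 x)))
    (oct_conj (oct_add (oct_mul (hc0 x) (hc1 y)) (oct_mul (hc0 y) (hc1 x))))).
(* All projections are unfolded in one pass: nested adjoints would otherwise be
   duplicated before their coordinates are extracted. *)
Ltac albert_unfold := cbv beta iota delta [albert_cross albert_T albert_norm
   albert_sharp albert_scale albert_add albert_zero
   oct_mul oct_add oct_scale oct_conj oct_norm oct_polar oct_tr oct_one oct_zero
   oa ob ou0 ou1 ou2 ox0 ox1 ox2 ha0 ha1 ha2 hc0 hc1 hc2].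
Ltac albert_unfold_ring := repeat intro;
  repeat match goal with x : albert |- _ => destruct x end;
  repeat match goal with p : oct |- _ => destruct p end;
  albert_unfold; try (congr Albert; try congr Oct); ring.
Fact albert_addA : associative albert_add. Proof. albert_unfold_ring. Qed.
Fact albert_addC : commutative albert_add. Proof. albert_unfold_ring. Qed.
Fact albert_add0 : left_id albert_zero albert_add. Proof. albert_unfold_ring. Qed.
Fact albert_addN : left_inverse albert_zero (albert_scale (-1)) albert_add.
Proof. albert_unfold_ring. Qed.
HB.instance Definition _ :=
  GRing.isZmodule.Build albert albert_addA albert_addC albert_add0 albert_addN.
Lemma albert_addE x y : x + y = albert_add x y. Proof. by []. Qed.
Fact albert_scaleA a b p : albert_scale a (albert_scale b p) = albert_scale (a * b) p.
Proof. albert_unfold_ring. Qed.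
Fact albert_scale1 : left_id 1 albert_scale. Proof. albert_unfold_ring. Qed.
Fact albert_scaleDr : right_distributive albert_scale +%R.
Proof. move=> a p q; rewrite !albert_addE; albert_unfold_ring. Qed.
Fact albert_scaleDl p : {morph albert_scale^~ p : a b / a + b}.
Proof. move=> a b; rewrite !albert_addE; albert_unfold_ring. Qed.
HB.instance Definition _ :=
  GRing.Zmodule_isLmodule.Build k albert
    albert_scaleA albert_scale1 albert_scaleDr albert_scaleDl.

Lemma albert_oppE x : - x = albert_scale (-1) x. Proof. by []. Qed.
Lemma albert_scaleE r x : r *: x = albert_scale r x. Proof. by []. Qed.

Ltac albert_ring := intros;
  rewrite ?(albert_addE, albert_oppE, albert_scaleE); albert_unfold_ring.

Lemma albert_crossC x y : albert_cross x y = albert_cross y x.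
Proof. albert_ring. Qed.
Lemma albert_crossDr x y z : albert_cross x (y + z) = albert_cross x y + albert_cross x z.
Proof. albert_ring. Qed.
Lemma albert_crossZr r x y : albert_cross x (r *: y) = r *: albert_cross x y.
Proof. albert_ring. Qed.
Lemma albert_crossZl r x y : albert_cross (r *: x) y = r *: albert_cross x y.
Proof. by rewrite !(albert_crossC _ y) albert_crossZr. Qed.
Lemma albert_crossNr x y : albert_cross x (- y) = - albert_cross x y.
Proof. by rewrite -!scaleN1r albert_crossZr. Qed.
Lemma albert_sharpD x y :
  albert_sharp (x + y) = albert_sharp x + albert_cross x y + albert_sharp y.
Proof. albert_ring. Qed.
Lemma albert_sharpZ r x : albert_sharp (r *: x) = r ^+ 2 *: albert_sharp x.
Proof. albert_ring. Qed.
Lemma albert_crossxx x : albert_cross x x = 2%:R *: albert_sharp x.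
Proof. albert_ring. Qed.
Lemma albert_TC x y : albert_T x y = albert_T y x.
Proof. albert_ring. Qed.
Lemma albert_TDr x y z : albert_T x (y + z) = albert_T x y + albert_T x z.
Proof. albert_ring. Qed.
Lemma albert_TZr r x y : albert_T x (r *: y) = r * albert_T x y.
Proof. albert_ring. Qed.
Lemma albert_TZl r x y : albert_T (r *: x) y = r * albert_T x y.
Proof. by rewrite !(albert_TC _ y) albert_TZr. Qed.
Lemma albert_TBr x y z : albert_T x (y - z) = albert_T x y - albert_T x z.
Proof. by rewrite albert_TDr -scaleN1r albert_TZr mulN1r. Qed.
Lemma albert_TBl x y z : albert_T (y - z) x = albert_T y x - albert_T z x.
Proof. by rewrite !(albert_TC _ x) albert_TBr. Qed.
Lemma albert_T_cross x y z : albert_T (albert_cross x y) z = albert_T x (albert_cross y z).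
Proof. albert_ring. Qed.
Lemma albert_normZ r x : albert_norm (r *: x) = r ^+ 3 * albert_norm x.
Proof. albert_ring. Qed.
Lemma albert_normD x y : albert_norm (x + y) =
  albert_norm x + albert_T (albert_sharp x) y + albert_T x (albert_sharp y) + albert_norm y.
Proof. albert_ring. Qed.
Lemma albert_T_sharp x : albert_T (albert_sharp x) x = 3%:R * albert_norm x.
Proof. albert_ring. Qed.
Lemma albert_adjoint x : albert_sharp (albert_sharp x) = albert_norm x *: x.
Proof. albert_ring. Qed.
(** The part of the adjoint identity at [x + t y] that is linear in [t]. *)
Lemma albert_adjoint_lin x y : albert_cross (albert_sharp x) (albert_cross x y) =
  albert_norm x *: y + albert_T (albert_sharp x) y *: x.
Proof. albert_ring. Qed.
Ltac dual_to E z := rewrite -(E z); albert_unfold; ring.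

(** The trace form is nondegenerate, which lets identities be transposed. *)
Lemma albert_T_inj x y : (forall z, albert_T x z = albert_T y z) -> x = y.
Proof.
move=> e.
have E z : albert_T x z - albert_T y z = 0 by rewrite e subrr.
move: E {e}; case: x => ? ? ? [? ? ? ? ? ? ? ?] [? ? ? ? ? ? ? ?] [? ? ? ? ? ? ? ?].
case: y => ? ? ? [? ? ? ? ? ? ? ?] [? ? ? ? ? ? ? ?] [? ? ? ? ? ? ? ?] E.
congr Albert; try congr Oct; apply/eqP; rewrite -subr_eq0; apply/eqP.
(* Under the trace form each diagonal entry is dual to itself, oa to ob, and
   oui to oxi; so the vectors below are those dual to the coordinates, in order. *)
- dual_to E (Albert 1 0 0 oct_zero oct_zero oct_zero).
- dual_to E (Albert 0 1 0 oct_zero oct_zero oct_zero).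
- dual_to E (Albert 0 0 1 oct_zero oct_zero oct_zero).
- dual_to E (Albert 0 0 0 (Oct 0 1 0 0 0 0 0 0) oct_zero oct_zero).
- dual_to E (Albert 0 0 0 (Oct 1 0 0 0 0 0 0 0) oct_zero oct_zero).
- dual_to E (Albert 0 0 0 (Oct 0 0 0 0 0 1 0 0) oct_zero oct_zero).
- dual_to E (Albert 0 0 0 (Oct 0 0 0 0 0 0 1 0) oct_zero oct_zero).
- dual_to E (Albert 0 0 0 (Oct 0 0 0 0 0 0 0 1) oct_zero oct_zero).
- dual_to E (Albert 0 0 0 (Oct 0 0 1 0 0 0 0 0) oct_zero oct_zero).
- dual_to E (Albert 0 0 0 (Oct 0 0 0 1 0 0 0 0) oct_zero oct_zero).
- dual_to E (Albert 0 0 0 (Oct 0 0 0 0 1 0 0 0) oct_zero oct_zero).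
- dual_to E (Albert 0 0 0 oct_zero (Oct 0 1 0 0 0 0 0 0) oct_zero).
- dual_to E (Albert 0 0 0 oct_zero (Oct 1 0 0 0 0 0 0 0) oct_zero).
- dual_to E (Albert 0 0 0 oct_zero (Oct 0 0 0 0 0 1 0 0) oct_zero).
- dual_to E (Albert 0 0 0 oct_zero (Oct 0 0 0 0 0 0 1 0) oct_zero).
- dual_to E (Albert 0 0 0 oct_zero (Oct 0 0 0 0 0 0 0 1) oct_zero).
- dual_to E (Albert 0 0 0 oct_zero (Oct 0 0 1 0 0 0 0 0) oct_zero).
- dual_to E (Albert 0 0 0 oct_zero (Oct 0 0 0 1 0 0 0 0) oct_zero).
- dual_to E (Albert 0 0 0 oct_zero (Oct 0 0 0 0 1 0 0 0) oct_zero).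
- dual_to E (Albert 0 0 0 oct_zero oct_zero (Oct 0 1 0 0 0 0 0 0)).
- dual_to E (Albert 0 0 0 oct_zero oct_zero (Oct 1 0 0 0 0 0 0 0)).
- dual_to E (Albert 0 0 0 oct_zero oct_zero (Oct 0 0 0 0 0 1 0 0)).
- dual_to E (Albert 0 0 0 oct_zero oct_zero (Oct 0 0 0 0 0 0 1 0)).
- dual_to E (Albert 0 0 0 oct_zero oct_zero (Oct 0 0 0 0 0 0 0 1)).
- dual_to E (Albert 0 0 0 oct_zero oct_zero (Oct 0 0 1 0 0 0 0 0)).
- dual_to E (Albert 0 0 0 oct_zero oct_zero (Oct 0 0 0 1 0 0 0 0)).
- dual_to E (Albert 0 0 0 oct_zero oct_zero (Oct 0 0 0 0 1 0 0 0)).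
Qed.
(** The transpose of [albert_adjoint_lin] under the trace form: both crossings are
    self-adjoint. *)
Lemma albert_adjoint_lin_dual x y : albert_cross x (albert_cross (albert_sharp x) y) =
  albert_norm x *: y + albert_T x y *: albert_sharp x.
Proof.
apply: albert_T_inj => z.
rewrite albert_crossC albert_T_cross (albert_crossC _ y) albert_T_cross.
rewrite albert_adjoint_lin albert_TDr albert_TZr !(albert_TC _ z) albert_TDr !albert_TZr.
rewrite !(albert_TC _ x) (albert_TC _ y); ring.
Qed.
(** The part of the adjoint identity at [x + t y] that is quadratic in [t]. *)
Lemma albert_adjoint_quad x y : albert_sharp (albert_cross x y) =
  albert_T (albert_sharp x) y *: y + albert_T (albert_sharp y) x *: x
  - albert_cross (albert_sharp x) (albert_sharp y).
Proof. albert_ring. Qed.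

Definition albert_U x y := albert_T x y *: x - albert_cross (albert_sharp x) y.

Lemma albert_UDr x y z : albert_U x (y + z) = albert_U x y + albert_U x z.
Proof. by rewrite /albert_U albert_TDr albert_crossDr scalerDl opprD addrACA. Qed.
Lemma albert_UZr r x y : albert_U x (r *: y) = r *: albert_U x y.
Proof. by rewrite /albert_U albert_TZr albert_crossZr scalerBr scalerA. Qed.
Lemma albert_UBr x y z : albert_U x (y - z) = albert_U x y - albert_U x z.
Proof. by rewrite -!scaleN1r albert_UDr albert_UZr. Qed.

Lemma albert_UZl r x y : albert_U (r *: x) y = r ^+ 2 *: albert_U x y.
Proof.
rewrite /albert_U albert_TZl albert_sharpZ albert_crossZl scalerBr !scalerA.
congr (_ *: _ - _).
by rewrite mulrAC.
Qed.

Lemma albert_T_U x y z : albert_T (albert_U x y) z = albert_T y (albert_U x z).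
Proof.
rewrite /albert_U albert_TBl albert_TBr albert_TZl albert_TZr albert_crossC albert_T_cross.
by rewrite (albert_TC y x) mulrC.
Qed.

(** Expand the adjoint of [T(x,y) x - x# * y]: the adjoint of [x# * y] is given by
    [albert_adjoint_quad], the cross term by [albert_adjoint_lin_dual], and what
    is left after cancellation is [T(x#,y#) x# - x## * y#]. *)
Lemma albert_sharp_U x y :
  albert_sharp (albert_U x y) = albert_U (albert_sharp x) (albert_sharp y).
Proof.
rewrite /albert_U albert_sharpD albert_sharpZ albert_crossZl albert_crossNr.
rewrite albert_adjoint_lin_dual -[- albert_cross _ y]scaleN1r albert_sharpZ albert_adjoint_quad.
rewrite albert_adjoint albert_crossZl albert_TZl (albert_TC (albert_sharp y)).
(* What remains is linear algebra in the vectors and scalars that occur. *)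
move: (albert_sharp x) (albert_T (albert_sharp x) _) (albert_T x y).
move: (albert_cross _ _) (albert_norm x).
albert_ring.
Qed.

Lemma albert_U_sharp x : albert_U x (albert_sharp x) = albert_norm x *: x.
Proof.
rewrite /albert_U albert_TC albert_T_sharp albert_crossxx albert_adjoint.
move: (albert_norm x); albert_ring.
Qed.
Lemma albert_U_cross x y :
  albert_U x (albert_cross x y) = albert_T (albert_sharp x) y *: x - albert_norm x *: y.
Proof.
rewrite /albert_U albert_adjoint_lin -albert_T_cross albert_crossxx albert_TZl.
move: (albert_T _ _) (albert_norm x); albert_ring.
Qed.
(** With [x## = N(x) x], the inner operator sends [y] to
    [T(x#,y) x# - N(x) x * y], and [U_x] is known on [x#] and on [x * y]. *)
Lemma albert_UK x y :
  albert_U x (albert_U (albert_sharp x) y) = albert_norm x ^+ 2 *: y.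
Proof.
rewrite {2}/albert_U albert_UBr albert_UZr albert_adjoint albert_crossZl albert_UZr.
rewrite albert_U_sharp albert_U_cross.
move: (albert_T _ _) (albert_norm x); albert_ring.
Qed.
Lemma albert_sharp_UK x y :
  albert_U (albert_sharp x) (albert_U x y) = albert_norm x ^+ 2 *: y.
Proof.
rewrite {1}/albert_U -albert_T_U albert_U_sharp albert_adjoint albert_TZl albert_crossZl.
rewrite /albert_U albert_crossDr albert_crossNr albert_crossZr albert_crossxx.
rewrite albert_adjoint_lin_dual.
move: (albert_T _ _) (albert_norm x) (albert_sharp x); albert_ring.
Qed.

(** The difference [F] of the two sides is a cubic form in [y] whose mixed
    polarizations vanish, so it is additive; and [F(y) y = 0].  An additive cubic
    form with this property is zero, as it vanishes on every vector having a
    coordinate 1. *)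
Lemma albert_norm_U x y u : u * albert_norm x = 1 ->
  albert_norm (albert_U x y) = albert_norm x ^+ 2 * albert_norm y.
Proof.
move=> ux; pose F z := albert_norm (albert_U x z) - albert_norm x ^+ 2 * albert_norm z.
have FZ r z : F (r *: z) = r ^+ 3 * F z.
  rewrite /F albert_UZr !albert_normZ; ring.
have FD z w : F (z + w) = F z + F w.
  (* The polarizations of N (U_x z) are T (U_x# z#, U_x w) = N(x)^2 T (z#, w)
     and its mirror image, as U is self-adjoint. *)
  rewrite /F albert_UDr !albert_normD !albert_sharp_U !albert_T_U.
  rewrite albert_sharp_UK albert_UK !albert_TZr; ring.
have F1 z : F z *: z = 0.
  (* Both N (U_x z) U_x z and N(x)^2 N(z) U_x z equal (U_x z)##. *)
  have FU : F z *: albert_U x z = 0.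
    rewrite /F scalerBl -albert_adjoint !albert_sharp_U !albert_adjoint.
    by rewrite albert_UZl albert_UZr scalerA subrr.
  have: albert_norm x ^+ 2 *: (F z *: z) = 0.
    rewrite -albert_sharp_UK albert_UZr FU -(scale0r 0) albert_UZr.
    by rewrite !scale0r.
  move/(congr1 (fun w => u ^+ 2 *: w)).
  by rewrite scaler0 scalerA -exprMn ux expr1n scale1r.
have F2 z : ha0 z = 1 -> F z = 0.
  by move=> z1; have := congr1 ha0 (F1 z); rewrite /= z1 mulr1.
pose e := Albert 1 0 0 oct_zero oct_zero oct_zero.
(* The first summand has upper left entry 1. *)
have -> : y = (y - (ha0 y - 1) *: e) + (ha0 y - 1) *: e by rewrite subrK.
apply/eqP; rewrite -subr_eq0 -/(F _) FD FZ (F2 e) // F2 ?mulr0 ?addr0 //=.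
by ring.
Qed.
End Albert.

(** * Descent along faithfully flat extensions *)

Section QuotientModule.
Local Open Scope quotient_scope.
Variables (R : comPzRingType) (M : lmodType R) (P : M -> Prop).
Hypotheses (P0 : P 0) (PD : forall x y, P x -> P y -> P (x + y))
  (PZ : forall r x, P x -> P (r *: x)).

Definition qmod_rel (x y : M) : bool := `[< P (x - y) >].
Lemma qmod_rel_refl : reflexive qmod_rel.
Proof. by move=> x; apply/asboolP; rewrite subrr. Qed.
Lemma qmod_relN x y : P (x - y) -> P (y - x).
Proof. by move/(PZ (-1)); rewrite scaleN1r opprB. Qed.
Lemma qmod_rel_sym : symmetric qmod_rel.
Proof. by move=> x y; apply/asboolP/asboolP => /qmod_relN. Qed.
Lemma qmod_rel_trans : transitive qmod_rel.
Proof.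
move=> y x z /asboolP xy /asboolP yz; apply/asboolP.
by rewrite -(subrK y x) -addrA; apply: PD.
Qed.
Canonical qmod_equiv :=
  EquivRel qmod_rel qmod_rel_refl qmod_rel_sym qmod_rel_trans.
Definition qmod := {eq_quot qmod_equiv}.
HB.instance Definition _ := Choice.on qmod.
Definition qcls (x : M) : qmod := \pi_({eq_quot qmod_equiv}) x.
Definition qrep (x : qmod) : M := repr (x : {eq_quot qmod_equiv}).
Lemma qclsP x y : qcls x = qcls y <-> P (x - y).
Proof. by split=> [/eqmodP/asboolP //|h]; apply/eqmodP/asboolP. Qed.
Lemma qrepK x : qcls (qrep x) = x. Proof. exact: reprK. Qed.
Lemma qrep_cls x : P (qrep (qcls x) - x).
Proof. by apply/qclsP; rewrite qrepK. Qed.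

Definition qmod_add (x y : qmod) := qcls (qrep x + qrep y).
Definition qmod_scale r (x : qmod) := qcls (r *: qrep x).
Lemma qmod_add_cls x y : qmod_add (qcls x) (qcls y) = qcls (x + y).
Proof. by apply/qclsP; rewrite opprD addrACA; apply: PD; apply: qrep_cls. Qed.
Lemma qmod_scale_cls r x : qmod_scale r (qcls x) = qcls (r *: x).
Proof. by apply/qclsP; rewrite -scalerBr; apply: PZ; apply: qrep_cls. Qed.
Lemma qmodW (Q : qmod -> Prop) : (forall x, Q (qcls x)) -> forall x, Q x.
Proof. by move=> h x; rewrite -(qrepK x). Qed.
Fact qmod_addA : associative qmod_add.
Proof.
elim/qmodW=> x; elim/qmodW=> y; elim/qmodW=> z.
by rewrite !qmod_add_cls addrA.
Qed.
Fact qmod_addC : commutative qmod_add.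
Proof. by elim/qmodW=> x; elim/qmodW=> y; rewrite !qmod_add_cls addrC. Qed.
Fact qmod_add0 : left_id (qcls 0) qmod_add.
Proof. by elim/qmodW=> x; rewrite qmod_add_cls add0r. Qed.
Fact qmod_addN : left_inverse (qcls 0) (qmod_scale (-1)) qmod_add.
Proof.
by elim/qmodW=> x; rewrite qmod_scale_cls qmod_add_cls scaleN1r addNr.
Qed.
HB.instance Definition _ :=
  GRing.isZmodule.Build qmod qmod_addA qmod_addC qmod_add0 qmod_addN.
Fact qmod_scaleA a b x : qmod_scale a (qmod_scale b x) = qmod_scale (a * b) x.
Proof. by elim/qmodW: x => x; rewrite !qmod_scale_cls scalerA. Qed.
Fact qmod_scale1 : left_id 1 qmod_scale.
Proof. by elim/qmodW=> x; rewrite qmod_scale_cls scale1r. Qed.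
Fact qmod_scaleDr : right_distributive qmod_scale +%R.
Proof.
move=> a; elim/qmodW=> x; elim/qmodW=> y.
by rewrite -[_ + _]/(qmod_add _ _) -[RHS]/(qmod_add _ _)
  !(qmod_add_cls, qmod_scale_cls) scalerDr.
Qed.
Fact qmod_scaleDl x : {morph qmod_scale^~ x : a b / a + b}.
Proof.
elim/qmodW: x => x a b.
by rewrite -[RHS]/(qmod_add _ _) !(qmod_add_cls, qmod_scale_cls) scalerDl.
Qed.
HB.instance Definition _ :=
  GRing.Zmodule_isLmodule.Build R qmod
    qmod_scaleA qmod_scale1 qmod_scaleDr qmod_scaleDl.
Lemma qcls_linear : linear qcls.
Proof.
by move=> a x y; rewrite -[RHS]/(qmod_add (qmod_scale a _) _) qmod_scale_cls qmod_add_cls.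
Qed.
Lemma qcls0 x : qcls x = 0 <-> P x.
Proof. by rewrite -[0]/(qcls 0) qclsP subr0. Qed.
End QuotientModule.

Section Flat.
Variables (R S : comPzRingType) (phi : {rmorphism R -> S}).
Hypothesis ff : faithfully_flat phi.

Lemma tens_eq0 (M : lmodType R) :
  (forall m : M, tpure phi m 1 = 0) -> forall x : tens phi M, x = 0.
Proof.
move=> h; elim/tens_ind => [m s|x y -> ->]; last by rewrite addr0.
by rewrite -[s]mulr1 -tpureZ h scaler0.
Qed.

(** If [m (x) 1 = 0], the embedding [R / ann(m) -> M] becomes zero over [S]; by
    flatness [R / ann(m)] itself becomes zero, hence is zero by faithfulness. *)
Lemma ff_pure_inj (M : lmodType R) (m : M) : tpure phi m 1 = 0 -> m = 0.
Proof.
move=> m0; case: ff => ffl fff.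
pose P (r : R^o) := (r : R) *: m = 0.
have P0 : P 0 by exact: scale0r.
have PD x y : P x -> P y -> P (x + y).
  by rewrite /P => ex ey; rewrite scalerDl ex ey addr0.
have PZ r x : P x -> P (r *: x) by rewrite /P => ex; rewrite -scalerA ex scaler0.
pose Q : lmodType R := qmod P0 PD PZ.
pose f (q : Q) : M := (qrep q : R) *: m.
have fE r : f (qcls P0 PD PZ r) = (r : R) *: m.
  apply/eqP; rewrite -subr_eq0 -scalerBl; apply/eqP.
  exact: (qrep_cls P0 PD PZ r).
have fl : linear f.
  move=> a x y; rewrite -(qrepK x) -(qrepK y) -qcls_linear !fE.
  by rewrite scalerDl -scalerA.
have fi : injective f.
  move=> x y; rewrite -(qrepK x) -(qrepK y) !fE => e.
  by apply/qclsP; rewrite /P scalerBl e subrr.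
have := fff Q _ (qcls P0 PD PZ (1 : R)).
move=> h; have: qcls P0 PD PZ (1 : R) = 0.
  pose F := Defs.Hom f fl; have Fi := ffl Q M F fi.
  apply: h; apply: tens_eq0 => q; apply: Fi.
  by rewrite linear0 tmapE /= /f tpure_bal -tpureZ m0 scaler0.
by move/qcls0; rewrite /P scale1r.
Qed.

Lemma ff_inj (M N : lmodType R) (f : {linear M -> N}) :
  injective (tmap (phi := phi) f) -> injective f.
Proof.
move=> fi x y e; apply/eqP; rewrite -subr_eq0; apply/eqP/ff_pure_inj/fi.
by rewrite linear0 tmapE linearB e subrr tpure0l.
Qed.

(** The cokernel becomes zero over [S]. *)
Lemma ff_surj (M N : lmodType R) (f : {linear M -> N}) :
  (forall y, exists x, tmap (phi := phi) f x = y) -> forall y, exists x, f x = y.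
Proof.
move=> fs; case: ff => _ fff.
pose P (y : N) := exists x, f x = y.
have P0 : P 0 by exists 0; rewrite linear0.
have PD x y : P x -> P y -> P (x + y).
  by move=> [u <-] [v <-]; exists (u + v); rewrite linearD.
have PZ r x : P x -> P (r *: x).
  by move=> [u <-]; exists (r *: u); rewrite linearZ.
pose g := Defs.Hom _ (@qcls_linear _ _ _ P0 PD PZ).
move=> y; suff /qcls0 : g y = 0 by [].
apply: fff; apply: tens_eq0 => q; rewrite -(qrepK q).
rewrite -[qcls _ _ _ _]/(g _) -tmapE; have [x <-] := fs (tpure phi (qrep q) 1).
move: x; apply: (@tens_ext _ _ _ _ _ (fun x => tmap g (tmap f x)) (fun=> 0)).
- by move=> u v; rewrite !tmapD.
- by move=> u v; rewrite addr0.
move=> m s; rewrite !tmapE /=; have -> : qcls P0 PD PZ (f m) = 0.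
  by apply/qcls0; exists m.
exact: tpure0l.
Qed.

Lemma ff_bij (M N : lmodType R) (f : {linear M -> N}) :
  bijective (tmap (phi := phi) f) -> bijective f.
Proof.
move=> [g gK Kg].
have fi : injective f by apply: ff_inj; apply: can_inj gK.
have fs : forall y, exists x, f x = y by apply: ff_surj => y; exists (g y).
have [h hK] := choice fs.
by exists h => // x; apply: fi; rewrite hK.
Qed.
End Flat.

(** * Tensor products of algebras *)

(** Restriction of scalars; the morphism is a parameter of the type so that it can
    carry the module structure. *)
Definition rmod (R T : comPzRingType) (psi : {rmorphism R -> T}) : Type := T.

Section Restriction.
Variables (R T : comPzRingType) (psi : {rmorphism R -> T}).
Local Notation rmod := (rmod psi).
HB.instance Definition _ := GRing.Zmodule.copy rmod T.
Definition rmod_scale (r : R) (t : rmod) : rmod := psi r * (t : T).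
Fact rmod_scaleA a b x : rmod_scale a (rmod_scale b x) = rmod_scale (a * b) x.
Proof. by rewrite /rmod_scale rmorphM mulrA. Qed.
Fact rmod_scale1 : left_id 1 rmod_scale.
Proof. by move=> x; rewrite /rmod_scale rmorph1 mul1r. Qed.
Fact rmod_scaleDr : right_distributive rmod_scale +%R.
Proof. by move=> a x y; apply: mulrDr. Qed.
Fact rmod_scaleDl x : {morph rmod_scale^~ x : a b / a + b}.
Proof. by move=> a b; rewrite /rmod_scale rmorphD mulrDl. Qed.
HB.instance Definition _ := GRing.Zmodule_isLmodule.Build R rmod
  rmod_scaleA rmod_scale1 rmod_scaleDr rmod_scaleDl.
Definition rmod_mul (x y : rmod) : rmod := (x : T) * (y : T).
Lemma rmod_mul_linl y : linear (rmod_mul^~ y).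
Proof. by move=> a u v; rewrite /rmod_mul mulrDl -mulrA. Qed.
Lemma rmod_mul_linr x : linear (rmod_mul x).
Proof. by move=> a u v; rewrite /rmod_mul mulrDr mulrCA. Qed.
Definition rmod_bil : bil rmod rmod rmod := Bil _ rmod_mul_linl rmod_mul_linr.
End Restriction.

Lemma tpureNl (R S : comPzRingType) (phi : {rmorphism R -> S}) (M : lmodType R)
  (m : M) s : tpure phi (- m) s = - tpure phi m s.
Proof. by rewrite -[- m]scaleN1r tpure_bal rmorphN1 -tpureZ scaleN1r. Qed.

(** Biadditive maps on a product of two tensor products are determined by their
    values on pure tensors. *)
Lemma tens_ext2 (R S S' : comPzRingType) (phi : {rmorphism R -> S})
    (phi' : {rmorphism R -> S'}) (M N : lmodType R) (A : zmodType)
    (f g : tens phi M -> tens phi' N -> A) :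
  (forall y, {morph f^~ y : x x' / x + x'}) -> (forall x, {morph f x : y y' / y + y'}) ->
  (forall y, {morph g^~ y : x x' / x + x'}) -> (forall x, {morph g x : y y' / y + y'}) ->
  (forall m s n t, f (tpure phi m s) (tpure phi' n t) = g (tpure phi m s) (tpure phi' n t)) ->
  forall x y, f x y = g x y.
Proof.
move=> fl fr gl gr e x y; move: x; apply: tens_ext => // m s.
by move: y; apply: tens_ext => // n t; apply: e.
Qed.

Section TensRing.
Variables (R S T : comPzRingType) (phi : {rmorphism R -> S}) (psi : {rmorphism R -> T}).
(** [T (x)_R S] as a ring. *)
Definition tens_ring : Type := tens phi (rmod psi).
HB.instance Definition _ := GRing.Zmodule.on tens_ring.
Let mul : tens_ring -> tens_ring -> tens_ring := tbil (rmod_bil psi).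
Let one : tens_ring := tpure phi ((1 : T) : rmod psi) 1.
Fact tens_ring_mulC : commutative mul.
Proof.
apply: tens_ext2 => [y|x|y|x|m s n t]; try exact: tbilDl; try exact: tbilDr.
by rewrite /mul !tbilE mulrC /= /rmod_mul [X in tpure _ X]mulrC.
Qed.
Fact tens_ring_mulA : associative mul.
Proof.
move=> x y z; move: x y.
apply: (tens_ext2 (f := fun x y => mul x (mul y z)) (g := fun x y => mul (mul x y) z));
  try by move=> v u u'; rewrite /mul !(tbilDl, tbilDr).
move=> m s n t; move: z.
apply: (@tens_ext _ _ _ _ _ (fun z => mul _ (mul _ z)) (fun z => mul (mul _ _) z)).
- by move=> u v; rewrite /mul !tbilDr.
- by move=> u v; rewrite /mul tbilDr.
by move=> p u; rewrite /mul !tbilE mulrA /= /rmod_mul [X in tpure _ X]mulrA.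
Qed.
Fact tens_ring_mul1 : left_id one mul.
Proof.
apply: (@tens_ext _ _ _ _ _ (mul one) id) => [||m s] //; first exact: tbilDr.
by rewrite /mul tbilE mul1r /= /rmod_mul mul1r.
Qed.
Fact tens_ring_mulDl : left_distributive mul +%R.
Proof. by move=> x y z; apply: tbilDl. Qed.
HB.instance Definition _ := GRing.Zmodule_isComPzRing.Build tens_ring
  tens_ring_mulA tens_ring_mulC tens_ring_mul1 tens_ring_mulDl.

Definition tens_inl (t : T) : tens_ring := tpure phi (t : rmod psi) 1.
Definition tens_inr (s : S) : tens_ring := tpure phi ((1 : T) : rmod psi) s.
Lemma tens_ring_mulE (a b : rmod psi) s t :
  (tpure phi a s : tens_ring) * tpure phi b t = tpure phi ((a : T) * b : rmod psi) (s * t).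
Proof. by rewrite [LHS]tbilE. Qed.
Fact tens_inl_add : zmod_morphism tens_inl.
Proof.
move=> a b; rewrite /tens_inl -[a - b]/((a : rmod psi) - b).
by rewrite tpureDl tpureNl.
Qed.
Fact tens_inl_mul : monoid_morphism tens_inl.
Proof. by split=> // a b; rewrite tens_ring_mulE mulr1. Qed.
HB.instance Definition _ := GRing.isZmodMorphism.Build T tens_ring tens_inl tens_inl_add.
HB.instance Definition _ := GRing.isMonoidMorphism.Build T tens_ring tens_inl tens_inl_mul.
Fact tens_inr_add : zmod_morphism tens_inr.
Proof.
move=> a b; rewrite /tens_inr tpureDr; congr (_ + _).
by rewrite -mulN1r -tpureZ scaleN1r.
Qed.
Fact tens_inr_mul : monoid_morphism tens_inr.
Proof. by split=> // a b; rewrite tens_ring_mulE mulr1. Qed.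
HB.instance Definition _ := GRing.isZmodMorphism.Build S tens_ring tens_inr tens_inr_add.
HB.instance Definition _ := GRing.isMonoidMorphism.Build S tens_ring tens_inr tens_inr_mul.
Lemma tens_in_comm r : tens_inl (psi r) = tens_inr (phi r).
Proof.
rewrite /tens_inl /tens_inr -[psi r]mulr1 -[psi r * 1]/(r *: (1 : rmod psi)).
by rewrite tpure_bal mulr1.
Qed.
End TensRing.

Section SplitCover.
Variables (S S0 S1 S2 S3 : comPzRingType).
Variables (p0 : {rmorphism S -> S0}) (p1 : {rmorphism S -> S1})
  (p2 : {rmorphism S -> S2}) (p3 : {rmorphism S -> S3}).
Hypothesis pb : bijective (fun r => (p0 r, p1 r, p2 r, p3 r)).

(** An [S]-linear section [sg] of [p] extends to a map from [M (x) S'] to [M]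
    sending [m (x) 1] to [sg 1 *: m]. *)
Lemma section_annihilates (S' : comPzRingType) (p : {rmorphism S -> S'}) (sg : S' -> S)
    (M : lmodType S) (m : M) :
  {morph sg : a b / a + b} -> (forall r a, sg (p r * a) = r * sg a) ->
  tpure p m 1 = 0 -> sg 1 *: m = 0.
Proof.
move=> sgD sgM m0; have bal : balanced p (fun (m : M) a => sg a *: m).
  split=> [s u v|u a b|r u s] /=.
  - by rewrite scalerDr.
  - by rewrite sgD scalerDl.
  - by rewrite sgM !scalerA mulrC.
by rewrite -(tliftE bal) m0 tlift0.
Qed.

(** The four values [h (.., 1, ..)] are orthogonal idempotents of [S] with sum 1,
    and the i-th kills [m] as soon as [m] dies over the i-th factor. *)
Lemma split_cover (M : lmodType S) (m : M) :
  tpure p0 m 1 = 0 -> tpure p1 m 1 = 0 -> tpure p2 m 1 = 0 ->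
  tpure p3 m 1 = 0 -> m = 0.
Proof.
have [h hK Kh] := pb => m0 m1 m2 m3.
have ext r r' : [/\ p0 r = p0 r', p1 r = p1 r', p2 r = p2 r' & p3 r = p3 r'] -> r = r'.
  by case=> e0 e1 e2 e3; apply: (bij_inj pb); rewrite e0 e1 e2 e3.
have h0 x : p0 (h x) = x.1.1.1 by have := congr1 (fun y => y.1.1.1) (Kh x).
have h1 x : p1 (h x) = x.1.1.2 by have := congr1 (fun y => y.1.1.2) (Kh x).
have h2 x : p2 (h x) = x.1.2 by have := congr1 (fun y => y.1.2) (Kh x).
have h3 x : p3 (h x) = x.2 by have := congr1 (fun y => y.2) (Kh x).
have hE := (h0, h1, h2, h3).
have one : 1 = h (1, 0, 0, 0) + h (0, 1, 0, 0) + h (0, 0, 1, 0) + h (0, 0, 0, 1).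
  by apply: ext; rewrite !rmorphD !rmorph1 !hE /= ?add0r ?addr0.
rewrite -[m]scale1r one !scalerDl.
rewrite (section_annihilates (sg := fun a => h (a, 0, 0, 0)) _ _ m0).
rewrite (section_annihilates (sg := fun a => h (0, a, 0, 0)) _ _ m1).
rewrite (section_annihilates (sg := fun a => h (0, 0, a, 0)) _ _ m2).
rewrite (section_annihilates (sg := fun a => h (0, 0, 0, a)) _ _ m3) ?addr0 //.
all: move=> ? ?; apply: ext.
all: by rewrite ?rmorphD ?rmorphM !hE /= ?add0r ?mulr0.
Qed.
End SplitCover.

Section Descent.
Variables (R S : comPzRingType) (phi : {rmorphism R -> S}).
Variables (S0 S1 S2 S3 : comPzRingType).
Variables (p0 : {rmorphism S -> S0}) (p1 : {rmorphism S -> S1})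
  (p2 : {rmorphism S -> S2}) (p3 : {rmorphism S -> S3}).
Hypothesis pb : bijective (fun r => (p0 r, p1 r, p2 r, p3 r)).
Hypothesis ff : faithfully_flat phi.
Variables (T : comPzRingType) (psi : {rmorphism R -> T}).

(** The test algebras are the commutative squares under [R -> T] and [R -> S -> S'],
    the universal one being [T (x)_R S (x)_S S']. *)
Definition vanishes_over (S' : comPzRingType) (p : {rmorphism S -> S'}) (t : T) :=
  forall (T' : comPzRingType) (g : {rmorphism T -> T'}) (c : {rmorphism S' -> T'}),
    (forall r, g (psi r) = c (p (phi r))) -> g t = 0.

Lemma vanishes_tpure (S' : comPzRingType) (p : {rmorphism S -> S'}) t :
  vanishes_over p t ->
  tpure p (tens_inl phi psi t : rmod (tens_inr phi psi)) 1 = 0.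
Proof.
pose T1 := tens_ring phi psi; pose T2 := tens_ring p (tens_inr phi psi).
pose i : {rmorphism T1 -> T2} := tens_inl p (tens_inr phi psi).
move=> h; apply: (h T2 (i \o tens_inl phi psi) (tens_inr p (tens_inr phi psi))).
by move=> r /=; rewrite tens_in_comm; apply: tens_in_comm.
Qed.

Lemma vanishes_eq0 t :
  vanishes_over p0 t -> vanishes_over p1 t -> vanishes_over p2 t ->
  vanishes_over p3 t -> t = 0.
Proof.
move=> h0 h1 h2 h3; apply: (ff_pure_inj ff (M := rmod psi)).
by apply: (split_cover pb (M := rmod (tens_inr phi psi))); apply: vanishes_tpure.
Qed.
End Descent.

(** * Octonion representations of quadratic algebras *)

Section OctMap.
Variables (k T : comPzRingType) (c : {rmorphism k -> T}).
Definition oct_map (p : oct k) : oct T :=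
  Oct (c (oa p)) (c (ob p)) (c (ou0 p)) (c (ou1 p)) (c (ou2 p))
      (c (ox0 p)) (c (ox1 p)) (c (ox2 p)).
Lemma oct_map_mul p q : oct_map (oct_mul p q) = oct_mul (oct_map p) (oct_map q).
Proof. by rewrite /oct_map /oct_mul /= !(rmorphD, rmorphN, rmorphM). Qed.
Lemma oct_map1 : oct_map (oct_one k) = oct_one T.
Proof. by rewrite /oct_map /oct_one /= !(rmorph0, rmorph1). Qed.
End OctMap.

Section TensExtra.
Variables (S T : comPzRingType) (c : {rmorphism S -> T}).
Lemma tring_mul (u v : tens c S^o) :
  tring (tbil (mul_bil S) u v) = (tring u : T) * tring v.
Proof.
move: u v; apply: (tens_ext2 (f := fun u v => tring (tbil (mul_bil S) u v))
   (g := fun u v => (tring u : T) * tring v)) => [v x y|u x y|v x y|u x y|m s n t].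
- by rewrite tbilDl tringD.
- by rewrite tbilDr tringD.
- by rewrite tringD mulrDl.
- by rewrite tringD mulrDr.
by rewrite tbilE !tringE /= rmorphM mulrACA.
Qed.
Lemma tring_inj : injective (@tring _ _ c).
Proof.
have K : cancel (@tring _ _ c) (fun t => tpure c ((1 : S) : S^o) t).
  apply: (@tens_ext _ _ _ _ _ (fun x => tpure c ((1 : S) : S^o) (tring x)) id) => //.
    by move=> x y; rewrite tringD tpureDr.
  by move=> m s; rewrite tringE -tpure_bal [_ *: _]mulr1.
exact: can_inj K.
Qed.
Lemma tmap_comp (M N P : lmodType S) (f : {linear M -> N}) (g : {linear N -> P})
  (h : {linear M -> P}) : (forall x, h x = g (f x)) ->
  forall x, tmap (phi := c) h x = tmap g (tmap f x).
Proof.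
move=> e; apply: tens_ext => [||m s]; first exact: tmapD.
  by move=> x y; rewrite !tmapD.
by rewrite !tmapE e.
Qed.
Lemma tmap_tbil (M N : lmodType S) (b : bil M M M) (b' : bil N N N)
    (f : {linear M -> N}) : (forall x y, f (b x y) = b' (f x) (f y)) ->
  forall x y, tmap (phi := c) f (tbil b x y) = tbil b' (tmap f x) (tmap f y).
Proof.
move=> e; apply: (tens_ext2 (f := fun x y => tmap f (tbil b x y))
   (g := fun x y => tbil b' (tmap f x) (tmap f y))) => [v x y|u x y|v x y|u x y|m s n t].
- by rewrite tbilDl tmapD.
- by rewrite tbilDr tmapD.
- by rewrite tmapD tbilDl.
- by rewrite tmapD tbilDr.
by rewrite tbilE !tmapE tbilE e.
Qed.
End TensExtra.

Section TmapExtra.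
Variables (S T : comPzRingType) (c : {rmorphism S -> T}) (M : lmodType S).
Lemma tmap_hom0 (N : lmodType S) (x : tens c M) : tmap (hom0 M N) x = 0.
Proof.
move: x; apply: (@tens_ext _ _ _ _ _ (tmap (hom0 M N)) (fun=> 0)).
- exact: tmapD.
- by move=> u v; rewrite addr0.
by move=> m s; rewrite tmapE tpure0l.
Qed.
Lemma tmap_homN (N : lmodType S) (f : Defs.hom M N) (x : tens c M) :
  tmap (homN f) x = - tmap f x.
Proof.
move: x; apply: (@tens_ext _ _ _ _ _ (tmap (homN f)) (fun x => - tmap f x)).
- exact: tmapD.
- by move=> u v; rewrite tmapD opprD.
move=> m s; rewrite !tmapE /= -[- f m]scaleN1r tpure_bal rmorphN1 -tpureZ.
exact: scaleN1r.
Qed.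
Lemma tmap_homZ (N : lmodType S) (a : S) (f : Defs.hom M N) (x : tens c M) :
  tmap (homZ a f) x = c a *: tmap f x.
Proof.
move: x; apply: (@tens_ext _ _ _ _ _ (tmap (homZ a f)) (fun x => c a *: tmap f x)).
- exact: tmapD.
- by move=> u v; rewrite tmapD scalerDr.
by move=> m s; rewrite !tmapE /= tpure_bal tpureZ.
Qed.
Lemma tmap_homid (x : tens c M) : tmap (homid M) x = x.
Proof.
move: x; apply: (@tens_ext _ _ _ _ _ (tmap (homid M)) id) => [||m s] //.
  exact: tmapD.
by rewrite tmapE.
Qed.
End TmapExtra.

Section TbcExtra.
Variables (S S1 T : comPzRingType) (p : {rmorphism S -> S1}) (c : {rmorphism S1 -> T}).
Lemma tbcV_tbil (M : lmodType S) (b : bil M M M) (x y : tens (c \o p) M) :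
  tbcV (tbil b x y) = tbil (tens_bil p b) (tbcV x) (tbcV y).
Proof.
move: x y; apply: (tens_ext2 (f := fun x y => tbcV (tbil b x y))
   (g := fun x y => tbil (tens_bil p b) (tbcV x) (tbcV y)))
   => [v x y|u x y|v x y|u x y|m s n t].
- by rewrite tbilDl tbcVD.
- by rewrite tbilDr tbcVD.
- by rewrite tbcVD tbilDl.
- by rewrite tbcVD tbilDr.
by rewrite tbilE !tbcVE tbilE /=; rewrite tbilE; rewrite mulr1.
Qed.
Lemma tring_tbcV (z : tens (c \o p) S^o) :
  tring (tmap (@tring _ _ p) (tbcV z)) = tring z.
Proof.
move: z; apply: (@tens_ext _ _ _ _ _ (fun z => tring (tmap (@tring _ _ p) (tbcV z)))).
- by move=> u v; rewrite tbcVD tmapD tringD.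
- exact: tringD.
by move=> m s; rewrite tbcVE tmapE 2!tringE /= tringE mulr1.
Qed.
End TbcExtra.

(** A multiplicative map from [C (x) T] to the octonions over [T] that carries the
    norm law of [C], evaluated at [T], to the octonion norm.  This is the data that
    the norm law of hermitian matrices, evaluated at [T], depends on. *)
Record octrep (S T : comPzRingType) (kp : {rmorphism S -> T}) (C : quad_alg S) :=
  OctRep {
  or_map :> {linear tens kp C -> oct T};
  or_mul : forall x y, or_map (tbil (qa_mul C) x y) = oct_mul (or_map x) (or_map y);
  or_one : or_map (tpure kp (qa_one C) 1) = oct_one T;
  or_norm : forall x, tring (qa_norm C T kp x) = oct_norm (or_map x) :> T }.

Section OctrepIso.
Variables (S S1 T : comPzRingType) (p : {rmorphism S -> S1}) (c : {rmorphism S1 -> T}).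
Variables (C : quad_alg S) (D : quad_alg S1) (f : {linear qa_bc p C -> D}).
Hypothesis iso : qa_iso f.
Variable r : octrep c D.
Definition octrep_iso_map (x : tens (c \o p) C) : oct T := r (tmap f (tbcV x)).
Lemma octrep_iso_linear : linear octrep_iso_map.
Proof. by move=> a x y; rewrite /octrep_iso_map tbcVD tbcVZ !linearP. Qed.
Let F := Defs.Hom octrep_iso_map octrep_iso_linear.
Lemma octrep_iso_mul (x y : tens (c \o p) C) :
  F (tbil (qa_mul C) x y) = oct_mul (F x) (F y).
Proof.
case: iso => _ _ fM _.
rewrite /F /= /octrep_iso_map tbcV_tbil -or_mul; congr (r _).
exact: (tmap_tbil (b := qa_mul (qa_bc p C)) fM).
Qed.
Lemma octrep_iso_one : F (tpure (c \o p) (qa_one C) 1) = oct_one T.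
Proof.
case: iso => _ f1 _ _.
by rewrite /F /= /octrep_iso_map tbcVE tmapE -(or_one r) -f1.
Qed.
Lemma octrep_iso_norm (x : tens (c \o p) C) :
  tring (qa_norm C T (c \o p) x) = oct_norm (F x) :> T.
Proof.
case: iso => _ _ _ fN.
have := fN T c (tbcV x); rewrite /F /= /octrep_iso_map -(or_norm r) => ->.
by rewrite tring_tbcV tbcVK.
Qed.
Definition octrep_iso : octrep (c \o p) C :=
  @OctRep _ _ _ _ F octrep_iso_mul octrep_iso_one octrep_iso_norm.
Lemma octrep_iso_inj : injective r -> injective octrep_iso.
Proof.
case: iso => fb _ _ _ ri x y /= /ri e.
apply: (can_inj (@tbcVK _ _ _ _ _ _)).
have [h hK Kh] := fb.
have tK (z : tens c (qa_bc p C)) (hl : linear h) :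
    tmap (Defs.Hom h hl) (tmap f z) = z.
  rewrite -(tmap_comp (h := homid _)); first exact: tmap_homid.
  by move=> u /=; rewrite hK.
have hl : linear h.
  by move=> a u v; apply: (can_inj hK); rewrite linearP !Kh.
by rewrite -[LHS](tK _ hl) e tK.
Qed.
End OctrepIso.

(** * The split composition algebras *)

(** A frame consists of eight linear forms that are the coordinates of a
    multiplicative map into the octonions; scalar extension of the forms yields an
    octonion representation over any algebra [T]. *)
Section Frame.
Variables (k : comPzRingType) (D : quad_alg k).
Variables fa fb fu0 fu1 fu2 fx0 fx1 fx2 : Defs.hom D k^o.
Definition frame_vec (m : D) : oct k :=
  Oct (fa m : k) (fb m) (fu0 m) (fu1 m) (fu2 m) (fx0 m) (fx1 m) (fx2 m).
Hypothesis frame_mul :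
  forall x y, frame_vec (qa_mul D x y) = oct_mul (frame_vec x) (frame_vec y).
Hypothesis frame_one : frame_vec (qa_one D) = oct_one k.
Variables (T : comPzRingType) (c : {rmorphism k -> T}).
Definition frame_ext (x : tens c D) : oct T :=
  Oct (tring (tmap fa x) : T) (tring (tmap fb x)) (tring (tmap fu0 x))
    (tring (tmap fu1 x)) (tring (tmap fu2 x)) (tring (tmap fx0 x))
    (tring (tmap fx1 x)) (tring (tmap fx2 x)).
Hypothesis frame_norm :
  forall x, tring (qa_norm D T c x) = oct_norm (frame_ext x) :> T.
Lemma frame_ext_linear : linear frame_ext.
Proof.
by move=> a x y; rewrite oct_scaleE oct_addE /oct_add /oct_scale /frame_ext /= !linearP.
Qed.
Let F := Defs.Hom frame_ext frame_ext_linear.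
Lemma frame_ext_pure m s : F (tpure c m s) = s *: oct_map c (frame_vec m).
Proof.
rewrite oct_scaleE /oct_scale /F /= /frame_ext !tmapE !tringE /=.
by congr Oct; rewrite mulrC.
Qed.
Lemma frame_ext_mul x y : F (tbil (qa_mul D) x y) = oct_mul (F x) (F y).
Proof.
move: x y; apply: (tens_ext2 (f := fun x y => F (tbil (qa_mul D) x y))
   (g := fun x y => oct_mul (F x) (F y))) => [v x y|u x y|v x y|u x y|m s n t].
- by rewrite tbilDl linearD.
- by rewrite tbilDr linearD.
- by rewrite linearD oct_mulDl.
- by rewrite linearD oct_mulDr.
by rewrite tbilE !frame_ext_pure oct_mulZZ frame_mul oct_map_mul.
Qed.
Lemma frame_ext_one : F (tpure c (qa_one D) 1) = oct_one T.
Proof. by rewrite frame_ext_pure scale1r frame_one oct_map1. Qed.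
Definition frame_octrep : octrep c D :=
  @OctRep _ _ _ _ F frame_ext_mul frame_ext_one frame_norm.
Lemma frame_octrep_pure m s :
  frame_octrep (tpure c m s) = s *: oct_map c (frame_vec m).
Proof. exact: frame_ext_pure. Qed.
End Frame.

(** Over extensions only the existence of a representation matters; injectivity is
    needed over [k] alone, to detect equalities in the algebra itself. *)
Definition embeds_in_oct (k : comPzRingType) (D : quad_alg k) : Prop :=
  (forall (T : comPzRingType) (c : {rmorphism k -> T}), inhabited (octrep c D)) /\
  exists r : octrep (idfun : {rmorphism k -> k}) D, injective r.

Lemma frame_embeds (k : comPzRingType) (D : quad_alg k)
    (fa fb fu0 fu1 fu2 fx0 fx1 fx2 : Defs.hom D k^o) :
  let e := frame_vec fa fb fu0 fu1 fu2 fx0 fx1 fx2 in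
  (forall x y, e (qa_mul D x y) = oct_mul (e x) (e y)) ->
  e (qa_one D) = oct_one k ->
  (forall (T : comPzRingType) (c : {rmorphism k -> T}) x,
    tring (qa_norm D T c x) =
      oct_norm (frame_ext fa fb fu0 fu1 fu2 fx0 fx1 fx2 x) :> T) ->
  injective e -> embeds_in_oct D.
Proof.
move=> e eM e1 eN ei.
pose r T c := frame_octrep eM e1 (eN T c).
split=> [T c|]; first by split; exact: r.
exists (r k idfun) => x y.
rewrite -(tidK x) -(tidK y) !frame_octrep_pure !scale1r => h.
congr tpure; apply: ei; move: h; rewrite /oct_map -/e.
by case: (e _) => ? ? ? ? ? ? ? ?; case: (e _).
Qed.

Section Models.
Variable k : comPzRingType.

(** The scalars are the octonions [(a 0; 0 a)]. *)
Lemma base_embeds : embeds_in_oct (base_alg k).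
Proof.
pose i := homid k^o; pose z := hom0 k^o k^o.
apply: (@frame_embeds k (base_alg k) i i z z z z z z).
- by move=> x y; rewrite /oct_mul /frame_vec /=; congr Oct; ring.
- by [].
- move=> T c x; rewrite /oct_norm /frame_ext /= tring_mul !tmap_hom0 !linear0.
  ring.
- by move=> x y [].
Qed.

(** The pairs are the diagonal octonions. *)
Lemma pair_embeds : embeds_in_oct (pair_alg k).
Proof.
pose z := hom0 (k^o * k^o)%type k^o.
apply: (@frame_embeds k (pair_alg k) (fst_hom _ _) (snd_hom _ _) z z z z z z).
- by move=> x y; rewrite /oct_mul /frame_vec /=; congr Oct; ring.
- by [].
- move=> T c x; rewrite /oct_norm /frame_ext /= tring_mul !tmap_hom0 !linear0.
  ring.
- by move=> [x1 x2] [y1 y2] [-> ->].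
Qed.

(** The matrix [(a b; c d)] is the octonion with diagonal [a, d] and vectors
    [(b, 0, 0)] and [(- c, 0, 0)]: the sign turns the scalar products of the
    octonions into those of matrices, and parallel vectors have no cross product. *)
Lemma mat2_embeds : embeds_in_oct (mat2_alg k).
Proof.
pose z := hom0 'M[k]_2 k^o; pose E := @entry_hom k.
apply: (@frame_embeds k (mat2_alg k) (E 0 0) (E 1 1) (E 0 1) z z (homN (E 1 0)) z z).
- move=> x y; rewrite /oct_mul /frame_vec /= !mxE !big_ord_recl !big_ord0.
  by rewrite (_ : lift ord0 ord0 = 1); [congr Oct; ring|exact: val_inj].
- by rewrite /frame_vec /= !mxE /= oppr0.
- move=> T c x; rewrite /oct_norm /frame_ext /= linearD linearN /= !tring_mul.
  rewrite !tmap_hom0 tmap_homN linearN !linear0 /=; ring.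
- move=> x y [] e00 e11 e01 /oppr_inj e10; apply/matrixP => i j.
  have ord2 (l : 'I_2) : l = 0 \/ l = 1.
    by case: l => -[|[|//]] hl; [left|right]; apply: val_inj.
  by case: (ord2 i) => ->; case: (ord2 j) => ->.
Qed.

Definition row_entry (j : 'I_3) : Defs.hom 'rV[k]_3 k^o.
Proof. by exists (fun u : 'rV[k]_3 => (u 0 j : k^o)) => a u v; rewrite !mxE. Defined.

Lemma sum3 (V : nmodType) (f : 'I_3 -> V) : \sum_i f i = f 0 + f 1 + f 2.
Proof.
rewrite !big_ord_recl big_ord0 addr0 addrA.
by congr (f _ + f _ + f _); apply: val_inj.
Qed.
Lemma ord3P (j : 'I_3) : [\/ j = 0, j = 1 | j = 2].
Proof.
by case: j => -[|[|[|//]]] hj; [constructor 1|constructor 2|constructor 3];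
  apply: val_inj.
Qed.
Lemma I3D : ((0 + 1 = 1 :> 'I_3)%R * (0 + 2 = 2 :> 'I_3)%R * (1 + 1 = 2 :> 'I_3)%R
  * (1 + 2 = 0 :> 'I_3)%R * (2 + 1 = 0 :> 'I_3)%R * (2 + 2 = 1 :> 'I_3)%R)%type.
Proof. by do ?split; apply: val_inj. Qed.

Lemma tring_dot (T : comPzRingType) (c : {rmorphism k -> T}) (u v : tens c 'rV[k]_3) :
  let t j u : T := tring (tmap (row_entry j) u) in
  tring (tbil (dot_bil k) u v) = t 0 u * t 0 v + t 1 u * t 1 v + t 2 u * t 2 v.
Proof.
move=> t.
have tD j x y : t j (x + y) = t j x + t j y by rewrite /t !linearD.
move: u v; apply: (tens_ext2 (f := fun u v => tring (tbil (dot_bil k) u v))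
  (g := fun u v => t 0 u * t 0 v + t 1 u * t 1 v + t 2 u * t 2 v))
  => [v x y|u x y|v x y|u x y|m s n r].
- by rewrite tbilDl tringD.
- by rewrite tbilDr tringD.
- by rewrite !tD; ring.
- by rewrite !tD; ring.
rewrite /t tbilE !tmapE !tringE /= /dot sum3 !rmorphD !rmorphM; ring.
Qed.

Definition hom_comp (M N P : lmodType k) (f : Defs.hom N P) (g : Defs.hom M N) : Defs.hom M P :=
  Defs.Hom _ (lin_comp (@hom_linear _ _ _ f) (@hom_linear _ _ _ g)).

Lemma zorn_embeds : embeds_in_oct (zorn_alg k).
Proof.
pose u j := hom_comp (row_entry j) (@zorn_u k).
pose x j := hom_comp (row_entry j) (@zorn_x k).
apply: (@frame_embeds k (zorn_alg k) (zorn_a1 k) (zorn_a2 k)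
   (u 0) (u 1) (u 2) (x 0) (x 1) (x 2)).
- move=> p q; rewrite /oct_mul /frame_vec /=; congr Oct;
    rewrite /zorn_mul /dot ?sum3 /= ?mxE ?I3D; ring.
- by rewrite /frame_vec /= !mxE.
- move=> T c p; rewrite /oct_norm /frame_ext /= linearD /= tring_mul tring_dot.
  have eu j : tmap (u j) p = tmap (row_entry j) (tmap (@zorn_u k) p).
    exact: tmap_comp.
  have ex j : tmap (x j) p = tmap (row_entry j) (tmap (@zorn_x k) p).
    exact: tmap_comp.
  by rewrite !eu !ex.
- move=> [[a b] [v w]] [[a' b'] [v' w']] [-> -> e0 e1 e2 f0 f1 f2].
  by congr ((_, _), (_, _)); apply/rowP => j; case: (ord3P j) => ->.
Qed.
End Models.

(** * From hermitian matrices to the split Albert algebra *)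

Section HerToAlbert.
Variables (S T : comPzRingType) (kp : {rmorphism S -> T}) (C : comp_alg S).
Variable r : octrep kp C.
Let n := qa_norm C.
Definition or_vec (x : C) : oct T := r (tpure kp x 1).
Lemma or_vecD x y : or_vec (x + y) = or_vec x + or_vec y.
Proof. by rewrite /or_vec tpureDl linearD. Qed.
Lemma or_vecZ a x : or_vec (a *: x) = kp a *: or_vec x.
Proof. by rewrite /or_vec tpure_bal -tpureZ linearZ. Qed.
Lemma or_vecN x : or_vec (- x) = - or_vec x.
Proof. by rewrite -!scaleN1r or_vecZ rmorphN1. Qed.
Lemma or_vecM x y : or_vec (qa_mul C x y) = oct_mul (or_vec x) (or_vec y).
Proof. by rewrite /or_vec -or_mul tbilE mulr1. Qed.
Lemma or_vec1 : or_vec (qa_one C) = oct_one T. Proof. exact: or_one. Qed.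
Lemma or_vec_norm x : kp (pl_eval n x) = oct_norm (or_vec x).
Proof. by rewrite /or_vec -(or_norm r) pl_pure tringE mulr1. Qed.
Lemma or_vec_polar x y : kp (polar n x y) = oct_polar (or_vec x) (or_vec y).
Proof. by rewrite /polar !rmorphB !or_vec_norm or_vecD oct_polarE. Qed.
Lemma or_vec_tr x : kp (comp_tr C x) = oct_tr (or_vec x).
Proof. by rewrite /= or_vec_polar or_vec1 oct_polar1. Qed.
Lemma or_vec_conj x : or_vec (comp_conj C x) = oct_conj (or_vec x).
Proof. by rewrite /= or_vecD or_vecZ or_vecN or_vec_tr or_vec1 oct_conjE. Qed.
Lemma or_tr x : tring (tmap (comp_tr C) x) = oct_tr (r x) :> T.
Proof.
move: x; apply: (@tens_ext _ _ _ _ _ (fun x => tring (tmap (comp_tr C) x) : T)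
  (fun x => oct_tr (r x))).
- by move=> x y; rewrite !linearD.
- by move=> x y; rewrite linearD oct_trD.
move=> x t; rewrite tmapE tringE or_vec_tr.
by rewrite -[t in RHS]mulr1 -tpureZ linearZ oct_trZ mulrC.
Qed.

Definition her_map (z : tens kp (her C)) : albert T :=
  Albert (tring (tmap (her_a C 0) z) : T) (tring (tmap (her_a C 1) z))
    (tring (tmap (her_a C 2) z)) (r (tmap (her_c C 0) z))
    (r (tmap (her_c C 1) z)) (r (tmap (her_c C 2) z)).
Lemma her_map_linear : linear her_map.
Proof. by move=> a x y; rewrite albert_scaleE albert_addE /her_map !linearP. Qed.
HB.instance Definition _ :=
  GRing.isLinear.Build T _ _ *:%R her_map her_map_linear.

(** An equality of laws: [z] ranges over the whole extension [Her_3(C) (x) T]. *)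
Lemma her_map_norm z : tring (her_norm C T kp z) = albert_norm (her_map z) :> T.
Proof.
rewrite /her_norm /albert_norm /her_map /= sum3 !tringD linearN /= !tringD.
by rewrite !tring_mul or_tr !or_mul !(or_norm r).
Qed.

Definition her_vec (y : her C) : albert T := her_map (tpure kp y 1).
Lemma her_vecE y : her_vec y =
  Albert (kp (y.1 0)) (kp (y.1 1)) (kp (y.1 2))
      (or_vec (y.2 0)) (or_vec (y.2 1)) (or_vec (y.2 2)).
Proof. by rewrite /her_vec /her_map !tmapE !tringE !mulr1. Qed.
Lemma her_map_pure y t : her_map (tpure kp y t) = t *: her_vec y.
Proof. by rewrite /her_vec -linearZ /= tpureZ mulr1. Qed.
Lemma her_vecD x y : her_vec (x + y) = her_vec x + her_vec y.
Proof. by rewrite /her_vec tpureDl linearD. Qed.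
Lemma her_vecZ a x : her_vec (a *: x) = kp a *: her_vec x.
Proof. by rewrite /her_vec tpure_bal -tpureZ linearZ. Qed.
Lemma her_vecN x : her_vec (- x) = - her_vec x.
Proof. by rewrite -!scaleN1r her_vecZ rmorphN1. Qed.
Lemma or_vec_sharp a x y z :
  or_vec (- (a *: x) + comp_conj C (qa_mul C y z)) =
  oct_add (oct_scale (- kp a) (or_vec x)) (oct_conj (oct_mul (or_vec y) (or_vec z))).
Proof.
by rewrite or_vecD or_vec_conj or_vecM -scaleNr or_vecZ rmorphN.
Qed.
Lemma her_vec_ffun (f : 'I_3 -> S^o) (g : 'I_3 -> C) :
  her_vec ([ffun i => f i], [ffun i => g i]) =
  Albert (kp (f 0)) (kp (f 1)) (kp (f 2)) (or_vec (g 0)) (or_vec (g 1)) (or_vec (g 2)).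
Proof. by rewrite her_vecE /= !ffunE. Qed.
Lemma her_vec_sharp x : her_vec (pl_eval (her_sharp C) x) = albert_sharp (her_vec x).
Proof.
rewrite her_sharpE her_vec_ffun her_vecE {1}/albert_sharp !I3D.
by rewrite !or_vec_sharp !rmorphB !rmorphM !or_vec_norm.
Qed.
Lemma her_vec_cross x y : her_vec (her_cross x y) = albert_cross (her_vec x) (her_vec y).
Proof.
rewrite /her_cross /polar !(her_vecD, her_vecN) !her_vec_sharp her_vecD albert_sharpD.
by rewrite addrAC addrK addrC addKr.
Qed.
Lemma her_vec_T x y : kp (her_T x y) = albert_T (her_vec x) (her_vec y).
Proof.
have E i : kp ((x.1 i : S) * y.1 i + polar n (x.2 i) (y.2 i)) =
    kp (x.1 i) * kp (y.1 i) + oct_polar (or_vec (x.2 i)) (or_vec (y.2 i)).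
  by rewrite rmorphD rmorphM or_vec_polar.
by rewrite /her_T rmorph_sum sum3 !E !her_vecE.
Qed.
Lemma her_vec_U x y : her_vec (pl_eval (her_U C) x y) = albert_U (her_vec x) (her_vec y).
Proof.
rewrite her_UE her_vecD her_vecN her_vecZ her_vec_cross her_vec_sharp her_vec_T.
by [].
Qed.
Lemma her_vec_norm x : kp (pl_eval (her_norm C) x) = albert_norm (her_vec x).
Proof. by rewrite /her_vec -her_map_norm pl_pure tringE mulr1. Qed.
End HerToAlbert.

(** * Norms of Freudenthal algebras *)

(** [C] becomes representable by octonions over [S'], faithfully on [C (x) S']. *)
Definition oct_over (S S' : comPzRingType) (p : {rmorphism S -> S'}) (C : quad_alg S) :=
  (forall (T : comPzRingType) (c : {rmorphism S' -> T}), inhabited (octrep (c \o p) C)) /\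
  exists r : octrep ((idfun : {rmorphism S' -> S'}) \o p) C, injective r.

Lemma iso_oct_over (S S' : comPzRingType) (p : {rmorphism S -> S'}) (C : quad_alg S)
    (D : quad_alg S') :
  qa_isomorphic (qa_bc p C) D -> embeds_in_oct D -> oct_over p C.
Proof.
move=> [f iso] [rT [r ri]]; split=> [T c|].
  by have [rc] := rT T c; split; apply: (octrep_iso iso rc).
by exists (octrep_iso iso r); apply: octrep_iso_inj.
Qed.

(** Each component of a split composition algebra is, over its factor of the base
    ring, one of the four models, hence represented by octonions. *)
Lemma split_oct_over (S : comPzRingType) (C : quad_alg S) : split_comp C ->
  exists (S0 S1 S2 S3 : comPzRingType)
    (p0 : {rmorphism S -> S0}) (p1 : {rmorphism S -> S1})
    (p2 : {rmorphism S -> S2}) (p3 : {rmorphism S -> S3}),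
    [/\ bijective (fun r => (p0 r, p1 r, p2 r, p3 r)),
        oct_over p0 C, oct_over p1 C, oct_over p2 C & oct_over p3 C].
Proof.
case=> [S0 [S1 [S2 [S3 [p0 [p1 [p2 [p3 [pb [_ i0] i1 i2 i3]]]]]]]]].
exists S0, S1, S2, S3, p0, p1, p2, p3; split=> //.
- exact: iso_oct_over i0 (base_embeds _).
- exact: iso_oct_over i1 (pair_embeds _).
- exact: iso_oct_over i2 (mat2_embeds _).
- exact: iso_oct_over i3 (zorn_embeds _).
Qed.

Section OverS.
Variables (S : comPzRingType) (C : comp_alg S).
Variables (S0 S1 S2 S3 : comPzRingType).
Variables (p0 : {rmorphism S -> S0}) (p1 : {rmorphism S -> S1})
  (p2 : {rmorphism S -> S2}) (p3 : {rmorphism S -> S3}).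
Hypothesis pb : bijective (fun r => (p0 r, p1 r, p2 r, p3 r)).
Hypotheses (o0 : oct_over p0 C) (o1 : oct_over p1 C)
  (o2 : oct_over p2 C) (o3 : oct_over p3 C).

(** Equalities in [Her_3(C)] can be checked in split Albert algebras: use the faithful
    representations over the four factors of [S]. *)
Lemma her_eq (d e : her C) :
  (forall (S' : comPzRingType) (p : {rmorphism S -> S'}) (r : octrep p C),
     her_vec r d = her_vec r e) -> d = e.
Proof.
move=> de.
have K (S' : comPzRingType) (p : {rmorphism S -> S'}) : oct_over p C ->
    (forall i, p (d.1 i) = p (e.1 i)) /\
    (forall i, tpure (idfun \o p) (d.2 i - e.2 i) 1 = 0).
  move=> [_ [r ri]]; have := de _ _ r; rewrite !her_vecE => -[].
  move=> a0 a1 a2 c0 c1 c2.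
  split=> i; first by case: (ord3P i) => ->.
  apply: ri; rewrite linear0 tpureDl linearD tpureNl linearN.
  rewrite -!/(or_vec _ _).
  by case: (ord3P i) => ->; rewrite ?c0 ?c1 ?c2 subrr.
have [a0 c0] := K _ _ o0; have [a1 c1] := K _ _ o1.
have [a2 c2] := K _ _ o2; have [a3 c3] := K _ _ o3.
case: d e {de K} a0 c0 a1 c1 a2 c2 a3 c3 => [d1 d2] [e1 e2] /= a0 c0 a1 c1 a2 c2 a3 c3.
congr (_, _); apply/ffunP => i.
  by apply: (bij_inj pb); rewrite a0 a1 a2 a3.
apply/eqP; rewrite -subr_eq0; apply/eqP.
exact: (split_cover (p0 := idfun \o p0) (p1 := idfun \o p1)
  (p2 := idfun \o p2) (p3 := idfun \o p3) pb).
Qed.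

Lemma her_UK (x y : her C) :
  pl_eval (her_U C) x (pl_eval (her_U C) (pl_eval (her_sharp C) x) y) =
  (pl_eval (her_norm C) x : S) ^+ 2 *: y.
Proof.
apply: her_eq => S' p r.
by rewrite her_vecZ !her_vec_U her_vec_sharp albert_UK rmorphXn (her_vec_norm r).
Qed.
Lemma her_sharp_UK (x y : her C) :
  pl_eval (her_U C) (pl_eval (her_sharp C) x) (pl_eval (her_U C) x y) =
  (pl_eval (her_norm C) x : S) ^+ 2 *: y.
Proof.
apply: her_eq => S' p r.
by rewrite her_vecZ !her_vec_U her_vec_sharp albert_sharp_UK rmorphXn (her_vec_norm r).
Qed.

Lemma her_U_bij (x : her C) u : u * (pl_eval (her_norm C) x : S) = 1 ->
  bijective (pl_eval (her_U C) x).
Proof.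
move=> ux; exists (fun y => u ^+ 2 *: pl_eval (her_U C) (pl_eval (her_sharp C) x) y) => y.
  by rewrite her_sharp_UK scalerA -exprMn ux expr1n scale1r.
by rewrite linearZ /= her_UK scalerA -exprMn ux expr1n scale1r.
Qed.
End OverS.

Lemma tring_tscal (R T T' : comPzRingType) (psi : {rmorphism R -> T})
    (psi' : {rmorphism R -> T'}) (g : {rmorphism T -> T'})
    (hg : forall r, g (psi r) = psi' r) (z : tens psi R^o) :
  tring (tscal psi psi' g z) = g (tring z) :> T'.
Proof.
move: z; apply: (@tens_ext _ _ _ _ _ (fun z => tring (tscal psi psi' g z) : T')
   (fun z => g (tring z))).
- by move=> x y; rewrite tscalD // tringD.
- by move=> x y; rewrite tringD rmorphD.
by move=> m s; rewrite tscalE // !tringE rmorphM hg.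
Qed.

Lemma pl_eq_eval (R : comPzRingType) (M N : lmodType R) (f g : polylaw M N) x :
  pl_eq f g -> pl_eval f x = pl_eval g x.
Proof. by move=> e; rewrite /pl_eval e. Qed.

Section Freud.
Variables (R S : comPzRingType) (phi : {rmorphism R -> S}) (J : pq_alg R).
Variables (N : polylaw J R^o) (C : comp_alg S) (f : {linear pq_bc phi J -> her3 C}).
Hypotheses (iso : pq_iso f)
  (fN : pl_eq (scalar_law_bc phi N) (pl_comp (her_norm C) (pl_lin f))).

Lemma iso_norm x : phi (pl_eval N x) = pl_eval (her_norm C) (f (tpure phi x 1)).
Proof.
have := pl_eq_eval (tpure phi x 1) fN; rewrite !pl_eval_comp !pl_eval_lin pl_eval_bc.
by rewrite pl_pure /= tringE mulr1 => ->.
Qed.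
Lemma pq_op_bc x : pq_op (tpure phi x 1 : pq_bc phi J) =
  Defs.Hom _ (tmap_linear (phi := phi) (pq_op x)).
Proof.
by rewrite /pq_op pl_eval_comp pl_eval_lin pl_eval_bc pl_pure /= thomE scale1r.
Qed.
Lemma iso_op x z : f (tmap (pq_op x) z) = pl_eval (her_U C) (f (tpure phi x 1)) (f z).
Proof. by have [_ _ fU] := iso; rewrite -[RHS]fU pq_op_bc. Qed.

Section Transfer.
Variables (T T' : comPzRingType) (psi : {rmorphism R -> T}) (g : {rmorphism T -> T'}).
Variables (kp : {rmorphism S -> T'}) (r : octrep kp C).
Hypothesis hg : forall a, g (psi a) = (kp \o phi) a.
(** From [J (x)_R T] to the split Albert algebra over [T']: extend scalars to [T'],
    view the result as an extension of [J (x)_R S], and apply the isomorphism with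
    hermitian matrices. *)
Definition transfer (w : tens psi J) : albert T' :=
  her_map r (tmap f (tbcV (tscal psi (kp \o phi) g w))).
Definition transfer_vec (y : J) : albert T' := her_vec r (f (tpure phi y 1)).
Lemma transferD x y : transfer (x + y) = transfer x + transfer y.
Proof. by rewrite /transfer tscalD // tbcVD !linearD. Qed.
Lemma transfer_pure y t : transfer (tpure psi y t) = g t *: transfer_vec y.
Proof. by rewrite /transfer tscalE // tbcVE tmapE her_map_pure. Qed.
Lemma transfer_norm w : g (tring (N T psi w)) = albert_norm (transfer w).
Proof.
rewrite -(tring_tscal hg) (pl_natural N hg) /transfer -her_map_norm.
have := @fN T' kp (tbcV (tscal psi (kp \o phi) g w)); rewrite /= => <-.
by rewrite tring_tbcV tbcVK.
Qed.
Lemma transfer_vec_norm x : g (psi (pl_eval N x)) = albert_norm (transfer_vec x).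
Proof. by rewrite hg /= iso_norm /transfer_vec -her_vec_norm. Qed.
Lemma transfer_U x w :
  transfer (tmap (pq_op x) w) = albert_U (transfer_vec x) (transfer w).
Proof.
move: w; apply: (@tens_ext _ _ _ _ _ (fun w => transfer (tmap (pq_op x) w))
  (fun w => albert_U (transfer_vec x) (transfer w))).
- by move=> u v; rewrite tmapD transferD.
- by move=> u v; rewrite transferD albert_UDr.
move=> y t; rewrite tmapE !transfer_pure albert_UZr; congr (_ *: _).
by rewrite /transfer_vec -her_vec_U -iso_op tmapE.
Qed.
End Transfer.

Hypothesis ff : faithfully_flat phi.
Hypothesis split : split_comp C.

Lemma norm_of_one : pl_eval N (pq_one J) = 1 :> R.
Proof.
apply/eqP; rewrite -subr_eq0; apply/eqP; apply: (ff_pure_inj ff (M := R^o)).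
apply: (@tring_inj _ _ phi); rewrite linear0 tringE mulr1 rmorphB rmorph1.
have [_ f1 _] := iso; rewrite iso_norm f1 her_normE /=.
rewrite !ffunE sum3 !ffunE (homog_eval0 (@qa_norm_quad _ C)) bil0r.
rewrite -[polar _ 0 _]/(comp_tr C 0) linear0; ring.
Qed.

(** By descent it suffices to invert [U_x] over [S], where [x] has an adjoint. *)
Lemma pq_norm_unit_invertible x u : u * (pl_eval N x : R) = 1 -> pq_invertible x.
Proof.
have [S0 [S1 [S2 [S3 [p0 [p1 [p2 [p3 [pb o0 o1 o2 o3]]]]]]]]] := split_oct_over split.
move=> ux; apply: (ff_bij ff).
have [fb _ _] := iso; have [h hK Kh] := fb.
have U : bijective (pl_eval (her_U C) (f (tpure phi x 1))).
  apply: (her_U_bij pb o0 o1 o2 o3 (u := phi u)).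
  by rewrite -iso_norm -rmorphM ux rmorph1.
have [V VK KV] := U; exists (fun z => h (V (f z))) => z.
  by rewrite iso_op VK hK.
by apply: (can_inj hK); rewrite iso_op Kh KV.
Qed.

(** An identity in [T], checked over the test algebras, where it is an instance of
    [albert_norm_U]. *)
Lemma pq_norm_U x u (T : comPzRingType) (psi : {rmorphism R -> T}) (w : tens psi J) :
  u * (pl_eval N x : R) = 1 ->
  N T psi (tmap (pq_op x) w) = psi (pl_eval N x) ^+ 2 *: N T psi w.
Proof.
have [S0 [S1 [S2 [S3 [p0 [p1 [p2 [p3 [pb o0 o1 o2 o3]]]]]]]]] := split_oct_over split.
move=> ux; apply: tring_inj; rewrite linearZ /=.
apply/eqP; rewrite -subr_eq0; apply/eqP.
have V (S' : comPzRingType) (p : {rmorphism S -> S'}) : oct_over p C ->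
    vanishes_over phi psi p (tring (N T psi (tmap (pq_op x) w))
      - psi (pl_eval N x) ^+ 2 *: tring (N T psi w)).
  move=> [rT _] T' g c hg; have [r] := rT T' c.
  have hg' a : g (psi a) = ((c \o p) \o phi) a by rewrite hg.
  rewrite rmorphB rmorphM rmorphXn !(transfer_norm r hg') (transfer_vec_norm r hg').
  rewrite (transfer_U r hg') (albert_norm_U _ (u := g (psi u))) ?subrr //.
  by rewrite -(transfer_vec_norm r hg') -!rmorphM ux !rmorph1.
by apply: (vanishes_eq0 pb ff); apply: V.
Qed.
End Freud.

Local Open Scope classical_set_scope.

Theorem lemma15p1 (R : comPzRingType) (J : pq_alg R) (N : polylaw J R^o)
    (freudenthal_J : freudenthal J) (norm_N : freudenthal_norm N) :
  [set alpha : R | [/\ runit alpha & similar_by N alpha]] =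
  [set alpha : R |
     [/\ runit alpha
       & exists x : J, [/\ pq_invertible x & pl_eval N x = alpha]]].
Proof.
have [N3 [S [phi [C [f [ff sp iso fN]]]]]] := norm_N.
apply/seteqP; split=> a /= [[b ab]].
  move=> [h [_ hN]]; split; first by exists b.
  have Na : pl_eval N (h (pq_one J)) = a.
    have := pl_eq_eval (pq_one J) hN.
    rewrite pl_eval_scale pl_eval_comp pl_eval_lin (norm_of_one iso fN ff) => <-.
    exact: mulr1.
  exists (h (pq_one J)); split=> //.
  by apply: (pq_norm_unit_invertible iso fN ff sp (u := b)); rewrite Na mulrC.
move=> [x [Ux Na]]; split; first by exists b.
have [V VK KV] := Ux.
have Vl : linear V.
  by move=> c y z; apply: (can_inj VK); rewrite linearP /= !KV.
(* The similarity is a U_x^-1. *)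
pose Vh := Defs.Hom V Vl; exists (homZ a Vh); split.
  exists (fun y => b *: pq_op x y) => y /=.
    by rewrite linearZ /= KV scalerA mulrC ab scale1r.
  by apply: (can_inj VK); rewrite linearZ /= KV scalerA ab scale1r.
move=> T psi w; rewrite [LHS]/= [RHS]/= tmap_homZ N3.
pose z := tmap (phi := psi) Vh w; rewrite -/z.
have -> : w = tmap (pq_op x) z.
  rewrite -(tmap_comp (h := homid J)) ?tmap_homid // => y.
  by rewrite /= KV.
rewrite (pq_norm_U iso fN ff sp (u := b)) ?Na ?(mulrC b) //.
by rewrite scalerA -exprS.
Qed.
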